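(* Consider the linear regression model, cost functions and notation described in the context, with $n\ge2$ and $P=\eta I_n$, where $\eta\in\mathbb{R}$. Assume the noise is Gaussian, $V\sim\mathcal N(0,\sigma^2I_N)$, and: (A1) the minimizers $\hat\eta_{\mathrm{EB}},\hat\eta_{\mathrm{Sy}},\hat\eta_{\mathrm{EEB}},\hat\eta_{\mathrm{MSEy}}$ (defined in the context) are interior points of $\Omega$; (A2) $P$ is positive definite and $\Phi^T\Phi/N\to\Sigma$ almost surely as $N\to\infty$, with $\Sigma\in\mathbb{R}^{n\times n}$ positive definite; (A3) the sets of minimizers $\eta_b^*$ of $W_b$ and $\eta_y^*$ of $W_y$ over $\Omega$ each consist of isolated points; (A4) $\|\Phi^T\Phi/N-\Sigma\|_F=O_p(\delta_N)$, where $\delta_N\to0$ and moreover $\delta_N=o(1/\sqrt N)$ as $N\to\infty$; (A5) $\Omega$ is an open subset of $\mathbb{R}$ (so that $\eta_b^*$ and $\eta_y^*$ are interior points of $\Omega$). Then, as $N\to\infty$, $$\sqrt N(\hat\eta_{\mathrm{EB}}-\eta_b^* )\xrightarrow{d}\mathcal N\left(0,\ \frac{4\sigma^2}{n^2}\theta_0^T\Sigma^{-1}\theta_0\right),\qquad \sqrt N(\hat\eta_{\mathrm{Sy}}-\eta_y^* )\xrightarrow{d}\mathcal N\left(0,\ \frac{4\sigma^2}{(\operatorname{Tr}(\Sigma^{-1}))^2}\theta_0^T\Sigma^{-3}\theta_0\right).$$ As $\lambda_n(\Sigma)\to0$ while the other eigenvalues $\lambda_i(\Sigma)$, $i=1,\dots,n-1$,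 are fixed, which leads to $\operatorname{cond}(\Sigma)\to\infty$, the ratio of the two limiting variances tends to $1/n^2$, i.e. $$\frac{\theta_0^T\Sigma^{-1}\theta_0/n^2}{\theta_0^T\Sigma^{-3}\theta_0/(\operatorname{Tr}(\Sigma^{-1}))^2}\longrightarrow\frac1{n^2}.$$
   Context: Model: $Y=\Phi\theta_0+V$, with $Y\in\mathbb{R}^N$, $\Phi\in\mathbb{R}^{N\times n}$ of full column rank $n$, $N>n$, true parameter $\theta_0\in\mathbb{R}^n$, and $V\in\mathbb{R}^N$ having i.i.d. entries of mean $0$ and variance $\sigma^2>0$. Dependence on $N$ is suppressed in the notation. Notation: $P=P(\eta)$ is the kernel matrix with hyper-parameter $\eta\in\Omega$, $Q=\Phi P\Phi^T+\sigma^2I_N$, $\hat\theta^{\mathrm R}(\eta)=P\Phi^TQ^{-1}Y$; $\|\cdot\|_2$ is the Euclidean norm and $\|\cdot\|_F$ the Frobenius norm; $\xrightarrow{d}$ denotes convergence in distribution. $\lambda_1(\Sigma)\ge\dots\ge\lambda_n(\Sigma)$ are the eigenvalues of $\Sigma$ and $\operatorname{cond}(\Sigma)=\lambda_1(\Sigma)/\lambda_n(\Sigma)$. $\xi_N=O_p(a_N)$ means: for every $\epsilon>0$ there is $L>0$ with $\mathbb P(|\xi_N/a_N|>L)<\epsilon$ for all $N$. Cost functions and minimizers over $\eta\in\Omega$: - $\hat\eta_{\mathrm{EB}}$ minimizes $\mathcal F_{\mathrm{EB}}=Y^TQ^{-1}Y+\log\det Q$; - $\hat\eta_{\mathrm{Sy}}$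 minimizes $\mathcal F_{\mathrm{Sy}}=\|Y-\Phi\hat\theta^{\mathrm R}(\eta)\|_2^2+2\sigma^2\operatorname{Tr}(\Phi P\Phi^TQ^{-1})$; - $\hat\eta_{\mathrm{EEB}}$ minimizes $\theta_0^T\Phi^TQ^{-1}\Phi\theta_0+\sigma^2\operatorname{Tr}(Q^{-1})+\log\det Q$; - $\hat\eta_{\mathrm{MSEy}}$ minimizes $\sigma^4\theta_0^T\Phi^TQ^{-2}\Phi\theta_0+\sigma^6\operatorname{Tr}(Q^{-2})-2\sigma^4\operatorname{Tr}(Q^{-1})+2N\sigma^2$. Limit functions: $W_b(\eta)=\theta_0^TP^{-1}\theta_0+\log\det P$ and $W_y(\eta)=\sigma^4\theta_0^TP^{-T}\Sigma^{-1}P^{-1}\theta_0-2\sigma^4\operatorname{Tr}(\Sigma^{-1}P^{-1})$; $\eta_b^*=\arg\min_{\eta\in\Omega}W_b$ and $\eta_y^*=\arg\min_{\eta\in\Omega}W_y$.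
   Formalization: The variance-ratio limit additionally assumes that θ_0 keeps a component bounded away from 0 along the eigenvector of λ_n(Σ) (it fails for θ_0 orthogonal to it); Φ, if random, is assumed independent of V; (A1) is only required with probability tending to one. *)

(* Defs.v *)
From HB Require Import structures.
From mathcomp Require Export all_boot all_order all_algebra.
From mathcomp Require Export all_classical all_reals all_analysis.

Set Implicit Arguments.
Unset Strict Implicit.
Unset Printing Implicit Defensive.

Import Order.TTheory GRing.Theory Num.Theory.
Import numFieldNormedType.Exports.

Local Open Scope classical_set_scope.
Local Open Scope ring_scope.

Section matrices.
Context {R : realType}.

Definition quad n (A : 'M[R]_n) (x : 'cV[R]_n) : R := (x^T *m A *m x) 0 0.

Definition posdefmx n (A : 'M[R]_n) : Prop :=
  A^T = A /\ (forall x : 'cV[R]_n, x != 0 -> 0 < quad A x).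

(* The Frobenius norm; on a column vector it is the Euclidean norm. *)
Definition fnorm m n (A : 'M[R]_(m, n)) : R :=
  Num.sqrt (\sum_i \sum_j A i j ^+ 2).

(* The roots of the characteristic polynomial, with multiplicity and in
   nonincreasing order. The default [::] is used only when the polynomial does
   not split over R, hence never for a symmetric matrix. *)
Definition eigenvalues n (A : 'M[R]_n) : seq R :=
  xget [::] [set s : seq R | sorted (fun x y => y <= x) s /\
                             char_poly A = \prod_(x <- s) ('X - x%:P)].

(* Numbered from 1: eigval 1 A is the largest and eigval n A the smallest. *)
Definition eigval n (i : nat) (A : 'M[R]_n) : R := (eigenvalues A)`_i.-1.

Definition cond n (A : 'M[R]_n) : R := eigval 1 A / eigval n A.

End matrices.

Section regression.
Context {R : realType} {N n : nat}.
Implicit Types (sigma : R) (Phi : 'M[R]_(N, n)) (theta : 'cV[R]_n)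
  (Y : 'cV[R]_N) (P : 'M[R]_n).

Definition Qmx sigma Phi P : 'M[R]_N :=
  Phi *m P *m Phi^T + (sigma ^+ 2)%:M.

Definition thetaR sigma Phi Y P : 'cV[R]_n :=
  P *m Phi^T *m invmx (Qmx sigma Phi P) *m Y.

Definition F_EB sigma Phi Y P : R :=
  let Q := Qmx sigma Phi P in
  quad (invmx Q) Y + ln (\det Q).

Definition F_Sy sigma Phi Y P : R :=
  let Q := Qmx sigma Phi P in
  fnorm (Y - Phi *m thetaR sigma Phi Y P) ^+ 2
  + 2 * sigma ^+ 2 * \tr (Phi *m P *m Phi^T *m invmx Q).

Definition F_EEB sigma Phi theta P : R :=
  let Q := Qmx sigma Phi P in
  quad (Phi^T *m invmx Q *m Phi) theta
  + sigma ^+ 2 * \tr (invmx Q) + ln (\det Q).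

Definition F_MSEy sigma Phi theta P : R :=
  let Q := Qmx sigma Phi P in
  sigma ^+ 4 * quad (Phi^T *m (invmx Q ^+ 2) *m Phi) theta
  + sigma ^+ 6 * \tr (invmx Q ^+ 2)
  - 2 * sigma ^+ 4 * \tr (invmx Q)
  + 2 * N%:R * sigma ^+ 2.

End regression.

Section limit_functions.
Context {R : realType} {n : nat}.
Implicit Types (sigma : R) (Sigma P : 'M[R]_n) (theta : 'cV[R]_n).

Definition W_b theta P : R := quad (invmx P) theta + ln (\det P).

Definition W_y sigma Sigma theta P : R :=
  sigma ^+ 4 * quad ((invmx P)^T *m invmx Sigma *m invmx P) theta
  - 2 * sigma ^+ 4 * \tr (invmx Sigma *m invmx P).

End limit_functions.

Definition argmin {R : realType} (D : set R) (f : R -> R) : set R :=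
  [set x | D x /\ (forall y, D y -> f x <= f y)].

Section probability.
Context {d : measure_display} {T : measurableType d} {R : realType}
  (Pr : probability T R).

Definition rvmx m n (X : 'I_m -> 'I_n -> {RV Pr >-> R}) (w : T) :
  'M[R]_(m, n) := \matrix_(i, j) X i j w.

Definition rvcol m (X : 'I_m -> {RV Pr >-> R}) (w : T) : 'cV[R]_m :=
  \col_i X i w.

Definition mutually_independent (I : finType) (X : I -> {RV Pr >-> R}) : Prop :=
  forall B : I -> set R, (forall i, measurable (B i)) ->
    Pr (\bigcap_i (X i @^-1` B i)) = (\prod_i Pr (X i @^-1` B i))%E.

Definition sigma_algebra_of (I : Type) (X : I -> {RV Pr >-> R}) :
  set (set T) :=
  <<s \bigcup_i preimage_set_system [set: T] (X i) measurable >>.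

Definition independent_families (I J : Type)
    (X : I -> {RV Pr >-> R}) (Y : J -> {RV Pr >-> R}) : Prop :=
  forall A B, sigma_algebra_of X A -> sigma_algebra_of Y B ->
    Pr (A `&` B) = (Pr A * Pr B)%E.

(* E N has inner probability tending to 1; no measurability of E N is required.
   Existence of the minimizers is asked in this sense: with Gaussian noise and
   kernels eta%:M, eta ranging over an open set of positive reals, for each fixed
   N the costs F_EB and F_Sy have no minimizer on an event of positive (though
   vanishing) probability, so existence cannot hold surely for every N. *)
Definition with_probability_tending_to_1 (E : nat -> set T) : Prop :=
  exists2 A : nat -> set T,
    (forall N, measurable (A N) /\ A N `<=` E N) &
    Pr (A N) @[N --> \oo] --> 1%E.

(* xi_N = O_p(a_N) for the indices N > n. As x / 0 = 0 in MathComp, this is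
   meaningful only when a N != 0. *)
Definition bigOp (n : nat) (xi : nat -> T -> R) (a : nat -> R) : Prop :=
  forall eps : R, 0 < eps -> exists2 L : R, 0 < L &
    forall N, (n < N)%N -> (Pr [set w | L < `|xi N w / a N| ]%R < eps%:E)%E.

(* Convergence of the distribution functions of the (measurable) X N to that of
   mu, at the continuity points of the latter. *)
Definition cvg_in_distribution (X : nat -> T -> R)
    (mu : probability (measurableTypeR R) R) : Prop :=
  forall x : R, {for x, continuous (fun y : R => mu `]-oo, y]%classic)} ->
    Pr [set w | X N w <= x]%R @[N --> \oo] --> mu `]-oo, x]%classic.

End probability.

(* N(0, v) for a variance v > 0: the library's normal_prob takes the standard
   deviation. *)
Definition centered_normal {R : realType} (v : R) :
    probability (measurableTypeR R) R :=
  normal_prob 0 (Num.sqrt v).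

(* Main.v *)
Require Import Defs.
From HB Require Import structures.
From mathcomp Require Import all_boot all_order all_algebra.
From mathcomp Require Import all_classical all_reals all_analysis.
From mathcomp Require Import fingroup perm complex measurable_realfun ring lra.

(** With [P = eta I] and [G = Phi^T Phi] diagonalised, [F_EB] and [F_Sy] become
    explicit sums over the eigenvalues [g_i] of [G].  Writing
    [s_i = sigma^2 / g_i] and [th] for the least squares estimate in the
    eigenbasis of [G], their stationarity equations read
      [sum_i 1 / (eta + s_i) = sum_i th_i^2 / (eta + s_i)^2] and
      [sum_i g_i^-1 / (eta + s_i)^2 = sum_i g_i^-1 th_i^2 / (eta + s_i)^3].
    As all [s_i] are of order [1 / N] and mutually comparable, {e every} positive
    solution is within [O(1 / N)] of [|th|^2 / n], resp. of
    [th^T G^-1 th / tr G^-1]: consistency of the minimisers comes for free.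
    It remains to expand these two functions of [th] around [theta0], where
    [sqrt N * (th - theta0)] has coordinates [sqrt (b^T (G / N)^-1 b) * Z] with
    [Z] exactly [N(0, sigma^2)]: conditionally on [Phi], [Z] is a linear
    combination of the noise with a unit coefficient vector.  (A4) makes
    [sqrt N * ((G / N)^-1 - Sigma^-1)] negligible, and Slutsky's argument
    concludes.  The variance ratio is computed in an eigenbasis of [Sigma_ k],
    where the smallest eigenvalue dominates all three quadratic expressions. *)

Set Implicit Arguments.
Unset Strict Implicit.
Unset Printing Implicit Defensive.
Import Order.TTheory GRing.Theory Num.Theory.
Import numFieldNormedType.Exports.
Local Open Scope classical_set_scope.
Local Open Scope ring_scope.

(** * Real symmetric matrices *)

Section real_spectral.
Context {R : realType}.

(** To first order each estimator feels the noise through one direction only, the gradient at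
    [theta0] of the function it follows: [2 theta0 / n] for [|th|^2 / n], and [2 S theta0 / \tr S]
    for [th^T S th / \tr S], where [S] is the inverse of [Sigma]. A direction [b] contributes the
    variance [sigma^2 b^T S b]; this is where the factors [4 / n^2] and [4 / (\tr S)^2] and the
    powers [S] and [S^3] come from. A single scalar Gaussian per estimator is therefore enough, and
    no multivariate law is formed. The event that a given value is a minimiser is not known to be
    measurable. All statements in probability are therefore made through measurable subevents, and
    the stochastic orders are built on inner probability. The bounds drawn from the stationarity
    equations are deterministic and hold at each outcome of such an event, in place of a uniform
    convergence of the costs over [Omega]. *)

Lemma sym_eigenvector n (A : 'M[R]_n.+1) : A^T = A ->
  exists a, exists2 v : 'rV[R]_n.+1, v != 0 & v *m A = a *: v.
Proof.
move=> Asym; pose f : {rmorphism R -> R[i]} := real_complex R.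
pose AC := map_mx f A.
have Ah : AC \is hermsymmx.
  apply: realsym_hermsym.
    apply/is_hermitianmxP; rewrite expr0 scale1r map_mx_id // /AC.
    by rewrite map_trmx Asym.
  by apply/mxOverP => i j; rewrite mxE; apply/complex_realP; exists (A i j).
have /orthomx_spectralP AE := hermitian_normalmx Ah.
have /mxOverP/(_ 0 0)/complex_realP[k dk] := hermitian_spectral_diag_real Ah.
move: AE dk (spectral_unit AC).
move: (spectralmx AC) (spectral_diag AC) => P D AE dk Pu.
have : eigenvalue AC (D 0 0).
  apply/eigenvalueP; exists (row 0 P).
    rewrite AE -row_mul !mulmxA mulmxV // mul1mx row_mul row_diag_mx.
    by rewrite -scalemxAl -rowE.
  apply: contraTneq isT => r0.
  have := congr1 (fun M => row 0 M) (mulmxV Pu).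
  rewrite row_mul r0 mul0mx row1 => /rowP/(_ 0).
  by rewrite !mxE !eqxx => /esym/eqP; rewrite oner_eq0.
(* Only the eigenvalue is kept from the complex side: being real, it is already a root of
   [char_poly A] over [R], and this yields a real eigenvector. *)
rewrite dk eigenvalue_root_char -(map_char_poly f) fmorph_root.
rewrite -eigenvalue_root_char => /eigenvalueP[v vA v0].
by exists k, v.
Qed.

(** The reflection along [e_0 - v] exchanges [e_0] and [v]. It completes a unit eigenvector to an
    orthogonal matrix without any Gram-Schmidt process. *)
Lemma householder n (v : 'rV[R]_n.+1) : (v *m v^T) 0 0 = 1 ->
  exists H : 'M[R]_n.+1, [/\ H^T = H, H *m H = 1%:M & row 0 H = v].
Proof.
move=> v1; pose w : 'rV[R]_n.+1 := delta_mx 0 0 - v.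
have [w0|w0] := eqVneq w 0.
  exists 1%:M; rewrite trmx1 mulmx1 row1; split=> //.
  by apply/eqP; rewrite -subr_eq0 -/w w0.
pose k := (w *m w^T) 0 0.
have wwE : w *m w^T = k%:M by rewrite [LHS]mx11_scalar.
have k0 : k != 0.
  apply: contra w0 => /eqP; rewrite /k !mxE => /psumr_eq0P k0.
  apply/eqP/rowP => j; rewrite [RHS]mxE; apply/eqP; rewrite -sqrf_eq0 expr2.
  have := k0 _ j isT; rewrite [w^T _ _]mxE => -> // i _.
  by rewrite [w^T _ _]mxE -expr2 sqr_ge0.
(* As [|v| = 1], [|e_0 - v|^2 = 2 (1 - v_0) = 2 w_0]; hence [2 w_0 / k = 1] and row 0 of the
   reflection is [e_0 - w = v]. *)
have kE : k = 2 - 2 * v 0 0.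
  rewrite /k /w linearB/= mulmxBr !mulmxBl trmx_delta mul_delta_mx.
  have -> : delta_mx 0 0 *m v^T = (v 0 0)%:M.
    by rewrite -rowE; apply/matrixP => i j; rewrite !ord1 !mxE eqxx mulr1n.
  have -> : v *m delta_mx 0 0 = (v 0 0)%:M :> 'M[R]_1.
    by rewrite -colE; apply/matrixP => i j; rewrite !ord1 !mxE eqxx mulr1n.
  have -> : v *m v^T = 1%:M by rewrite [LHS]mx11_scalar v1.
  by rewrite !mxE !eqxx /= !mulr1n; ring.
exists (1%:M - (2 / k) *: (w^T *m w)); split.
- by rewrite linearB linearZ /= trmx_mul trmxK trmx1.
- rewrite mulmxBr mulmx1 mulmxBl mul1mx -!scalemxAl -!scalemxAr scalerA.
  rewrite mulmxA -(mulmxA w^T) wwE mul_mx_scalar -scalemxAl scalerA opprB.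
  have -> : 2 / k * (2 / k) * k = 2 / k + 2 / k by field.
  by rewrite scalerDl addrK subrK.
- rewrite linearB linearZ /= row1 row_mul.
  have -> : row 0 w^T = (w 0 0)%:M.
    by apply/matrixP => i j; rewrite !ord1 !mxE eqxx mulr1n.
  rewrite mul_scalar_mx scalerA.
  have -> : 2 / k * w 0 0 = 1.
    have -> : w 0 0 = k / 2 by rewrite kE /w !mxE !eqxx /=; field.
    by field.
  by rewrite scale1r /w subKr.
Qed.

(** Deflation: conjugating by a reflection whose row 0 is a unit eigenvector makes the first row a
    multiple of [e_0]; by symmetry so is the first column, and the remaining block is symmetric of
    smaller size. *)
Lemma sym_diagonalizable n (A : 'M[R]_n) : A^T = A ->
  exists U : 'M[R]_n, exists2 d : 'rV[R]_n,
    U *m U^T = 1%:M & A = U^T *m diag_mx d *m U.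
Proof.
elim: n A => [|n IHn] A Asym.
  by exists 0, 0; apply/matrixP => -[].
have [a [v v0 vA]] := sym_eigenvector Asym.
pose k := (v *m v^T) 0 0.
have k0 : 0 < k.
  have [j vj] : exists j, v 0 j != 0.
    by apply/existsP; apply: contraNT v0 => /existsPn vj; apply/eqP/rowP => j;
      rewrite mxE; apply/eqP; have := vj j; rewrite negbK.
  rewrite /k mxE (bigD1 j) //= ltr_pwDl //.
    by rewrite [v^T _ _]mxE -expr2 exprn_even_gt0.
  by apply: sumr_ge0 => i _; rewrite [v^T _ _]mxE -expr2 sqr_ge0.
pose u := (Num.sqrt k)^-1 *: v.
have uA : u *m A = a *: u by rewrite -scalemxAl vA !scalerA mulrC.
have u1 : (u *m u^T) 0 0 = 1.
  rewrite /u linearZ /= -scalemxAl -scalemxAr scalerA mxE -/k -invfM -expr2.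
  by rewrite sqr_sqrtr ?ltW// mulVf ?gt_eqF.
have [H [Hsym HH Hu]] := householder u1.
pose B : 'M[R]_(1 + n) := H *m A *m H.
have Bsym : B^T = B by rewrite /B !trmx_mul Hsym Asym mulmxA.
have B0 : row 0 B = a *: delta_mx 0 0.
  rewrite /B !row_mul Hu uA -scalemxAl -Hu -row_mul HH; congr (_ *: _).
  by apply/rowP => j; rewrite !mxE eqxx /= eq_sym.
have AB : A = H *m B *m H.
  by rewrite /B !mulmxA HH mul1mx -mulmxA HH mulmx1.
clearbody B.
have Bur : ursubmx B = 0.
  apply/rowP => j; rewrite !mxE; have /rowP/(_ (rshift 1 j)) := B0.
  by rewrite !mxE eqxx /= mulr0 => <-; congr (B _ _); apply/val_inj.
have Bul : ulsubmx B = a%:M.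
  apply/rowP => j; rewrite !mxE; have /rowP/(_ (lshift n j)) := B0.
  rewrite !mxE !ord1 eqxx/= mulr1n => H1; rewrite -[RHS]mulr1.
  rewrite -[X in _ * X]/(true%:R); etransitivity; last exact: H1.
  by congr (B _ _); apply/val_inj.
have Bdl : dlsubmx B = 0 by rewrite -[B]Bsym -trmx_ursub Bur trmx0.
have [|U' [d' U'1 U'E]] := IHn (drsubmx B); first by rewrite trmx_drsub Bsym.
have BE : B = block_mx a%:M 0 0 (drsubmx B).
  by rewrite -[LHS]submxK Bur Bdl Bul.
pose W : 'M[R]_(1 + n) := block_mx 1%:M 0 0 U'.
have WT : W^T = block_mx 1%:M 0 0 U'^T by rewrite /W tr_block_mx !trmx0 trmx1.
have W1 : W *m W^T = 1%:M.
  rewrite WT mulmx_block !mulmx0 !mul0mx !mulmx1 !addr0 add0r U'1.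
  by rewrite -scalar_mx_block.
pose D : 'rV[R]_(1 + n) := row_mx a%:M d'.
have BD : B = W^T *m diag_mx D *m W.
  rewrite BE U'E diag_mx_row WT !mulmx_block.
  rewrite !mulmx0 !mul0mx !mulmx1 !mul1mx !addr0 !add0r.
  congr block_mx; rewrite ?mul0mx //.
  by apply/matrixP => i j; rewrite !ord1 !mxE.
exists (W *m H), D.
  by rewrite trmx_mul Hsym mulmxA -(mulmxA W) HH mulmx1.
by rewrite AB BD trmx_mul Hsym !mulmxA.
Qed.

End real_spectral.

(** * Functional calculus in a fixed eigenbasis *)

Section spectral_calculus.
Context {R : realType} {n : nat}.
Implicit Types (U A : 'M[R]_n) (d e : 'I_n -> R) (x : 'cV[R]_n).

(** For orthogonal [U] the rows of [U] are eigenvectors. With [d] a plain function, the algebra of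
    matrices sharing [U] becomes pointwise arithmetic. *)
Definition spec U d : 'M[R]_n := U^T *m diag_mx (\row_i d i) *m U.

Lemma specE U d i j : spec U d i j = \sum_k U k i * d k * U k j.
Proof.
rewrite /spec mxE; apply: eq_bigr => k _; by rewrite mul_mx_diag !mxE.
Qed.

Lemma spec_exists A : A^T = A -> exists U d, U *m U^T = 1%:M /\ A = spec U d.
Proof.
move=> /sym_diagonalizable[U [d U1 ->]]; exists U, (fun i => d 0 i); split => //.
by rewrite /spec; congr (_ *m diag_mx _ *m _); apply/rowP => i; rewrite mxE.
Qed.

Lemma eq_spec U d e : d =1 e -> spec U d = spec U e.
Proof. by move=> /funext ->. Qed.

Lemma specD U d e : spec U d + spec U e = spec U (fun i => d i + e i).
Proof.
apply/matrixP => i j; rewrite mxE !specE -big_split; apply: eq_bigr => k _ /=.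
by rewrite mulrDr mulrDl.
Qed.

Lemma specZ U d a : a *: spec U d = spec U (fun i => a * d i).
Proof.
apply/matrixP => i j; rewrite mxE !specE mulr_sumr; apply: eq_bigr => k _ /=.
by ring.
Qed.

Lemma quad_spec U d x : quad (spec U d) x = \sum_i d i * ((U *m x) i 0) ^+ 2.
Proof.
rewrite /quad /spec !mulmxA -trmx_mul -mulmxA; move: (U *m x) => y.
by rewrite mxE; apply: eq_bigr => i _; rewrite mul_mx_diag !mxE; ring.
Qed.

Variable U : 'M[R]_n.
Hypothesis U1 : U *m U^T = 1%:M.

Let UT1 : U^T *m U = 1%:M. Proof. exact: mulmx1C. Qed.

Lemma spec_scalar a : spec U (fun=> a) = a%:M.
Proof.
rewrite /spec (_ : diag_mx _ = a%:M) ?mul_mx_scalar -?scalemxAl ?UT1 ?scalemx1//.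
by apply/matrixP => i j; rewrite !mxE.
Qed.

Lemma specM d e : spec U d *m spec U e = spec U (fun i => d i * e i).
Proof.
rewrite /spec !mulmxA -[_ *m U *m U^T]mulmxA U1 mulmx1 -[_ *m _ *m diag_mx _]mulmxA.
rewrite mulmx_diag; congr (_ *m diag_mx _ *m _).
by apply/rowP => i; rewrite !mxE.
Qed.

Lemma tr_spec d : \tr (spec U d) = \sum_i d i.
Proof.
rewrite /spec -mulmxA mxtrace_mulC -mulmxA U1 mulmx1 mxtrace_diag.
by apply: eq_bigr => i _; rewrite mxE.
Qed.

Lemma det_spec d : \det (spec U d) = \prod_i d i.
Proof.
rewrite /spec !det_mulmx mulrAC -det_mulmx UT1 det1 mul1r det_diag.
by apply: eq_bigr => i _; rewrite mxE.
Qed.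

Lemma spec_unit d : (forall i, d i != 0) -> spec U d \in unitmx.
Proof. by move=> d0; rewrite unitmxE det_spec unitfE; apply/prodf_neq0 => i _. Qed.

Lemma spec_inv d : (forall i, d i != 0) ->
  invmx (spec U d) = spec U (fun i => (d i)^-1).
Proof.
move=> d0; have [dE du] : spec U d *m spec U (fun i => (d i)^-1) = 1%:M /\
    spec U d \in unitmx.
  split; last exact: spec_unit.
  rewrite specM -spec_scalar; apply: eq_spec => i /=; exact: divff.
by rewrite -[LHS]mulmx1 -dE mulKmx.
Qed.

Lemma sum_sqr_spec x : \sum_i ((U *m x) i 0) ^+ 2 = (x^T *m x) 0 0.
Proof.
have -> : x^T *m x = (U *m x)^T *m (U *m x).
  by rewrite trmx_mul mulmxA -(mulmxA x^T) UT1 mulmx1.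
by move: (U *m x) => y; rewrite mxE; apply: eq_bigr => i _; rewrite mxE expr2.
Qed.

Lemma posdef_spec d : posdefmx (spec U d) -> forall i, 0 < d i.
Proof.
move=> [_ pd] i; have := pd (U^T *m delta_mx i 0).
have -> : U^T *m (delta_mx i 0 : 'cV_n) != 0.
  apply: contraTneq isT => /(congr1 (mulmx U)); rewrite mulmx0 mulmxA U1 mul1mx.
  by move=> /matrixP/(_ i 0); rewrite !mxE !eqxx => /eqP; rewrite oner_eq0.
move=> /(_ isT); rewrite quad_spec (bigD1 i) //= big1 ?addr0.
  by rewrite mulmxA U1 mul1mx mxE !eqxx expr1n mulr1.
move=> j ji; rewrite mulmxA U1 mul1mx mxE (negbTE ji) /= expr2 !mulr0 //.
Qed.

Lemma char_poly_spec d : char_poly (spec U d) = \prod_i ('X - (d i)%:P).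
Proof.
rewrite /char_poly /char_poly_mx; pose p (M : 'M[R]_n) := map_mx polyC M.
rewrite -!/(p _).
have pU : p U^T *m p U = 1%:M by rewrite /p -map_mxM UT1 map_mx1.
have -> : 'X%:M - p (spec U d) = p U^T *m
    ('X%:M - p (diag_mx (\row_i d i))) *m p U.
  rewrite mulmxBr mulmxBl mul_mx_scalar -scalemxAl pU scalemx1.
  by rewrite /spec /p !map_mxM.
rewrite !det_mulmx mulrAC -det_mulmx pU det1 mul1r.
have -> : 'X%:M - p (diag_mx (\row_i d i)) =
    diag_mx (\row_i ('X - (d i)%:P)).
  apply/matrixP => i j; rewrite !mxE.
  by case: eqP => [->|_]; rewrite ?mulr1n // !mulr0n subr0.
by rewrite det_diag; apply: eq_bigr => i _; rewrite mxE.
Qed.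

End spectral_calculus.

Section eigenvalues_spec.
Context {R : realType} {n : nat}.
Implicit Types (U A : 'M[R]_n).

(** Sorting the entries of some diagonalisation shows that the choice in [eigenvalues] never falls
    back on its default. Unique factorisation then identifies the chosen list with these entries up
    to a permutation, which is absorbed into the rows of [U]. *)
Lemma spec_eigval A : A^T = A ->
  exists2 U : 'M[R]_n, U *m U^T = 1%:M & A = spec U (fun i : 'I_n => eigval i.+1 A).
Proof.
move=> /spec_exists[U [d [U1 AE]]].
pose t : n.-tuple R := [tuple d i | i < n].
have cA : char_poly A = \prod_(x <- t) ('X - x%:P).
  by rewrite AE char_poly_spec // big_map val_ord_tuple big_enum.
have [_ es] : sorted (fun x y => y <= x) (eigenvalues A) /\
    char_poly A = \prod_(x <- eigenvalues A) ('X - x%:P).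
  rewrite /eigenvalues; case: xgetP => [_ -> //|/(_ (sort (fun x y => y <= x) t))].
  case; split; first by apply: sort_sorted => x y; exact: le_total.
  by rewrite cA; apply: perm_big; rewrite perm_sym perm_sort.
have : perm_eq (eigenvalues A) t by apply: prod_XsubC_eq; rewrite -es cA.
case/tuple_permP => s sE.
have eE (i : 'I_n) : eigval i.+1 A = d (s i).
  by rewrite /eigval sE nth_mktuple tnth_mktuple.
exists (row_perm s U).
  by rewrite row_permE trmx_mul mulmxA -(mulmxA (perm_mx s)) U1 mulmx1
    tr_perm_mx -perm_mxM mulgV perm_mx1.
rewrite {1}AE; apply/matrixP => i j; rewrite !specE (reindex_perm s) /=.
by apply: eq_bigr => k _; rewrite eE !mxE.
Qed.

End eigenvalues_spec.

(** * The variance ratio when one eigenvalue degenerates *)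

Section ill_conditioned.
Context {R : realType} {n : nat}.
Implicit Types (U A : 'M[R]_n) (d : 'I_n -> R) (x : 'cV[R]_n).

Lemma specX U d k : U *m U^T = 1%:M ->
  spec U d ^+ k = spec U (fun i => d i ^+ k).
Proof.
move=> U1; elim: k => [|k IHk].
  rewrite expr0; transitivity (1%:M : 'M[R]_n) => //.
  by rewrite -(spec_scalar U1); apply: eq_spec => i; rewrite expr0.
by rewrite exprS IHk -mulmxE specM //; apply: eq_spec => i; rewrite exprS.
Qed.

(** Let [e = d j] be the small eigenvalue, [t] the squared coordinate of [x] along it, and [b1],
    [b3] the shares of the other eigenvalues in the two quadratic forms. Clearing the powers of [e]
    turns the ratio into [(t + e b1) (1 + e L)^2 / (t + e^3 b3)], with [b1 <= T L], [b3 <= T L^3]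
    and [t >= c]. Both bounds tend to 1 with [e], the other quantities being fixed. *)
Lemma variance_ratio_bounds U d x (j : 'I_n) (c L : R) : U *m U^T = 1%:M ->
  (forall i, 0 < d i) -> 0 < c -> c <= ((U *m x) j 0) ^+ 2 ->
  L = \sum_(i | i != j) (d i)^-1 ->
  let T := (x^T *m x) 0 0 in
  let A := spec U d in
  let r := quad (invmx A) x / (quad (invmx A ^+ 3) x / (\tr (invmx A)) ^+ 2) in
  (1 + d j ^+ 3 * (T * L ^+ 3 / c))^-1 <= r
    <= (1 + d j * (T * L / c)) * (1 + d j * L) ^+ 2.
Proof.
move=> U1 d0 c0 ct LE /=.
have dN0 i : d i != 0 by rewrite gt_eqF.
rewrite spec_inv // specX // !quad_spec tr_spec //.
rewrite -(sum_sqr_spec U1 x).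
set y := fun i => (U *m x) i 0.
rewrite -/(y j) in ct *.
under eq_bigr do rewrite -/(y _).
under [X in _ <= _ / (X / _)]eq_bigr do rewrite -/(y _).
under [X in _ <= X / _ <= _]eq_bigr do rewrite -/(y _).
set T := \sum_i _.
have L0 : 0 <= L by rewrite LE; apply: sumr_ge0 => i _; rewrite invr_ge0 ltW.
have invL i : i != j -> (d i)^-1 <= L.
  move=> ij; rewrite LE (bigD1 i) //= lerDl.
  by apply: sumr_ge0 => k _; rewrite invr_ge0 ltW.
have T0 : 0 <= T by apply: sumr_ge0 => i _; exact: sqr_ge0.
have B (k : nat) : exists2 b, 0 <= b <= T * L ^+ k &
    \sum_i (d i)^-1 ^+ k * y i ^+ 2 = (d j)^-1 ^+ k * y j ^+ 2 + b.
  exists (\sum_(i | i != j) (d i)^-1 ^+ k * y i ^+ 2); last by rewrite (bigD1 j).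
  apply/andP; split.
    by apply: sumr_ge0 => i _; rewrite mulr_ge0 ?sqr_ge0 // exprn_ge0 // invr_ge0 ltW.
  apply: (@le_trans _ _ (\sum_(i | i != j) y i ^+ 2 * L ^+ k)).
    apply: ler_sum => i ij; rewrite mulrC ler_wpM2l ?sqr_ge0 // lerXn2r ?invL //.
    by rewrite nnegrE invr_ge0 ltW.
  rewrite -mulr_suml ler_wpM2r ?exprn_ge0 // /T [leRHS](bigD1 j) //= lerDr.
  exact: sqr_ge0.
have [b1 /andP[b10 b1T] b1E] := B 1%N; have [b3 /andP[b30 b3T] b3E] := B 3%N.
have -> : \sum_i (d i)^-1 * y i ^+ 2 = (d j)^-1 * y j ^+ 2 + b1.
  by rewrite -[(d j)^-1]expr1 -b1E; apply: eq_bigr => i _; rewrite expr1.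
rewrite b3E.
have -> : \sum_i (d i)^-1 = (d j)^-1 + L by rewrite LE (bigD1 j).
rewrite expr1 in b1T.
set e := d j; set t := y j ^+ 2.
have e0 : 0 < e by exact: d0.
have t0 : 0 < t by exact: lt_le_trans ct.
have pos1 : 0 < e^-1 ^+ 3 * t + b3.
  by rewrite ltr_pwDl // mulr_gt0 // exprn_gt0 // invr_gt0.
have pos2 : 0 < t + e ^+ 3 * b3.
  by rewrite ltr_pwDl // mulr_ge0 // exprn_ge0 // ltW.
have pos3 : 0 < e^-1 + L by rewrite ltr_pwDl // invr_gt0.
have -> : (e^-1 * t + b1) / ((e^-1 ^+ 3 * t + b3) / (e^-1 + L) ^+ 2) =
    (t + e * b1) * (1 + e * L) ^+ 2 / (t + e ^+ 3 * b3).
  field; rewrite !gt_eqF //=; rewrite mulrC in pos2.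
  by rewrite ltr_pwDl // mulr_ge0 // ltW.
have one1 : 1 <= (1 + e * L) ^+ 2.
  by rewrite exprn_ege1 // lerDl mulr_ge0 // ltW.
apply/andP; split.
  rewrite ler_pdivlMr // ler_pdivrMl; last first.
    by rewrite ltr_pwDl // mulr_ge0 ?exprn_ge0 ?divr_ge0 ?mulr_ge0 ?exprn_ge0 // ltW.
  apply: (@le_trans _ _ ((1 + e ^+ 3 * (T * L ^+ 3 / c)) * t)).
    rewrite mulrDl mul1r lerD2l -mulrA ler_wpM2l ?exprn_ge0 ?(ltW e0) //.
    apply: (le_trans b3T); rewrite -mulrA ler_peMr ?mulr_ge0 ?exprn_ge0 //.
    by rewrite mulrC ler_pdivlMr // mul1r.
  apply: ler_wpM2l.
    by rewrite addr_ge0 // mulr_ge0 ?exprn_ge0 ?divr_ge0 ?mulr_ge0 ?exprn_ge0 // ltW.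
  apply: (@le_trans _ _ (t + e * b1)); first by rewrite lerDl mulr_ge0 // ltW.
  by rewrite ler_peMr // addr_ge0 ?(ltW t0) // mulr_ge0 // ltW.
rewrite ler_pdivrMr // mulrAC ler_wpM2r ?sqr_ge0 //.
apply: (@le_trans _ _ ((1 + e * (T * L / c)) * t)); last first.
  rewrite ler_wpM2l ?lerDl ?mulr_ge0 ?exprn_ge0 // ?(ltW e0) //.
  by rewrite addr_ge0 // mulr_ge0 ?divr_ge0 ?mulr_ge0 // ltW.
rewrite mulrDl mul1r lerD2l -mulrA ler_wpM2l ?(ltW e0) //.
apply: (le_trans b1T); rewrite -mulrA ler_peMr ?mulr_ge0 //.
by rewrite mulrC ler_pdivlMr // mul1r.
Qed.

End ill_conditioned.

Section ill_conditioned_limit.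
Context {R : realType}.

Lemma ill_conditioned_limit n (n_ge2 : (2 <= n)%N) (theta0 : 'cV[R]_n)
  (Sigma_ : nat -> 'M[R]_n) :
  (forall k, posdefmx (Sigma_ k)) ->
  (forall k l i, (1 <= i < n)%N ->
     eigval i (Sigma_ k) = eigval i (Sigma_ l)) ->
  eigval n (Sigma_ k) @[k --> \oo] --> 0 ->
  cond (Sigma_ k) @[k --> \oo] --> +oo /\
  forall (u : nat -> 'cV[R]_n) (c : R),
    (forall k, Sigma_ k *m u k = eigval n (Sigma_ k) *: u k /\
               fnorm (u k) = 1) ->
    0 < c -> (forall k, c <= `|((u k)^T *m theta0) 0 0|) ->
    (quad (invmx (Sigma_ k)) theta0 / n%:R ^+ 2)
      / (quad (invmx (Sigma_ k) ^+ 3) theta0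
         / (\tr (invmx (Sigma_ k))) ^+ 2)
      @[k --> \oo] --> (1 / n%:R ^+ 2 : R).
Proof.
move=> pd fixed e_to0.
have n0 : (0 < n)%N by exact: leq_trans n_ge2.
have ltn : (n.-1 < n)%N by rewrite prednK.
pose j := Ordinal ltn.
have jE : j.+1 = n by rewrite /= prednK.
have neqj (i : 'I_n) : i != j -> (i.+1 < n)%N.
  rewrite -val_eqE /= => ij; rewrite ltn_neqAle (ltn_ord i) andbT.
  by apply: contra ij => /eqP ij; apply/eqP; exact: (congr1 predn ij).
pose e k := eigval n (Sigma_ k).
have lam_gt0 k (i : 'I_n) : 0 < eigval i.+1 (Sigma_ k).
  have [U U1 SE] := spec_eigval (pd k).1.
  by have := pd k; rewrite {1}SE => /(posdef_spec U1)/(_ i).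
have e_gt0 k : 0 < e k by rewrite /e -[X in eigval X]jE.
have fix0 k (i : 'I_n) : i != j -> eigval i.+1 (Sigma_ k) = eigval i.+1 (Sigma_ 0).
  by move=> ij; apply: fixed; rewrite neqj.
split.
  (* Since [n >= 2], the largest eigenvalue is one of those that stay fixed. *)
  have -> : (fun k => cond (Sigma_ k)) = (fun k => eigval 1 (Sigma_ 0) * (e k)^-1).
    by apply/funext => k; rewrite /cond (fixed k 0%N 1%N).
  have l1 : 0 < eigval 1 (Sigma_ 0) by have := lam_gt0 0%N (Ordinal n0).
  apply/cvgryPge => A.
  have A0 : 0 < `|A| + 1 by rewrite ltr_wpDl.
  near=> k; rewrite ler_pdivlMr //.
  apply: (@le_trans _ _ ((`|A| + 1) * e k)).
    by rewrite ler_wpM2r ?(ltW (e_gt0 k)) // (le_trans (ler_norm A)) // lerDl.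
  rewrite -ler_pdivlMl // -(gtr0_norm (e_gt0 k)) ltW //.
  near: k; move/cvgr0Pnorm_lt : e_to0; apply.
  by rewrite mulr_gt0 ?invr_gt0.
move=> u c uE c0 cu.
pose L : R := \sum_(i | i != j) (eigval i.+1 (Sigma_ 0))^-1.
pose T : R := (theta0^T *m theta0) 0 0.
(* Strictness matters: once the smallest eigenvalue is simple, [u k] equals row [j] of [U] up to
   sign, so that [c] bounds the coordinate of [theta0] in the basis at hand. *)
have e_small : \forall k \near \oo, forall i : 'I_n,
    i != j -> e k < eigval i.+1 (Sigma_ 0).
  apply: filter_forall => i; near=> k => _; rewrite -(gtr0_norm (e_gt0 k)).
  by near: k; move/cvgr0Pnorm_lt : e_to0; apply.
pose r k := quad (invmx (Sigma_ k)) theta0 / (quad (invmx (Sigma_ k) ^+ 3) theta0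
         / (\tr (invmx (Sigma_ k))) ^+ 2).
suff r1 : r k @[k --> \oo] --> (1 : R).
  have -> : (fun k => (quad (invmx (Sigma_ k)) theta0 / n%:R ^+ 2)
      / (quad (invmx (Sigma_ k) ^+ 3) theta0
         / (\tr (invmx (Sigma_ k))) ^+ 2)) = (fun k => r k * (n%:R ^+ 2)^-1).
    by apply/funext => k; rewrite /r mulrAC.
  by apply: cvgMl.
apply: (@squeeze_cvgr _ _ _ _ (fun k => (1 + e k ^+ 3 * (T * L ^+ 3 / c ^+ 2))^-1)
   (fun k => (1 + e k * (T * L / c ^+ 2)) * (1 + e k * L) ^+ 2)).
- near=> k.
  have [U U1 SE] := spec_eigval (pd k).1.
  have [uk u1] := uE k.
  pose y := U *m u k.
  have y0 i : i != j -> y i 0 = 0.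
    move=> ij; have : U *m (Sigma_ k *m u k) = e k *: y by rewrite uk -scalemxAr.
    rewrite {1}SE /spec !mulmxA U1 mul1mx -mulmxA -/y => /matrixP/(_ i 0).
    rewrite mul_diag_mx !mxE => /eqP; rewrite -subr_eq0 -mulrBl mulf_eq0.
    rewrite subr_eq0 fix0 // gt_eqF /=; first by move/eqP.
    by apply: (near e_small k).
  have yj : y j 0 ^+ 2 = 1.
    have := sum_sqr_spec U1 (u k); rewrite (bigD1 j) //= big1 ?addr0 => [->|i ij].
      rewrite -[RHS](expr1n _ 2) -u1 /fnorm sqr_sqrtr; last first.
        by apply: sumr_ge0 => i _; apply: sumr_ge0 => l _; exact: sqr_ge0.
      rewrite mxE; apply: eq_bigr => i _; by rewrite big_ord1 !mxE expr2.
    by rewrite -/y y0 // expr2 mulr0.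
  have ct : c ^+ 2 <= ((U *m theta0) j 0) ^+ 2.
    have -> : ((U *m theta0) j 0) ^+ 2 = (((u k)^T *m theta0) 0 0) ^+ 2.
      rewrite -[theta0 in RHS]mul1mx -(mulmx1C U1) mulmxA mulmxA -trmx_mul -/y -mulmxA.
      move: (U *m theta0) => z; rewrite [in RHS]mxE (bigD1 j) //= big1 ?addr0.
        by rewrite exprMn mxE yj mul1r.
      by move=> i ij; rewrite mxE y0 // mul0r.
    rewrite -real_normK ?num_real // -[leRHS]real_normK ?num_real // lerXn2r ?nnegrE //.
    by rewrite gtr0_norm.
  have := @variance_ratio_bounds _ _ U (fun i => eigval i.+1 (Sigma_ k)) theta0 j
    (c ^+ 2) L U1 (lam_gt0 k) _ ct _.
  rewrite /= -SE -/(r k) -/T prednK //; apply.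
    by rewrite exprn_gt0.
  by rewrite /L; apply: eq_bigr => i ij; rewrite fix0.
- rewrite -[X in _ --> X]invr1; apply: cvgV; first exact: oner_neq0.
  rewrite -[X in _ --> X]addr0; apply: cvgD; first exact: cvg_cst.
  rewrite -[X in _ --> X](mul0r (T * L ^+ 3 / c ^+ 2)); apply: cvgMl.
  have := cvg_comp _ _ e_to0 (@exprn_continuous R 3 0).
  by rewrite expr0n.
- have affine a : (1 + e k * a) @[k --> \oo] --> (1 : R).
    rewrite -[X in _ --> X]addr0; apply: cvgD; first exact: cvg_cst.
    by rewrite -[X in _ --> X](mul0r a); apply: cvgMl.
  rewrite -[X in _ --> X]mulr1; apply: cvgM; first exact: affine.
  have := cvg_comp _ _ (affine L) (@exprn_continuous R 2 1).
  by rewrite expr1n.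
Unshelve. all: by end_near.
Qed.

End ill_conditioned_limit.

(** * Cost functions and their stationary points *)

Section scalar_kernel_costs.
Context {R : realType} {N n : nat}.
Implicit Types (Phi : 'M[R]_(N, n)) (Y : 'cV[R]_N) (sigma h : R).

(** Sylvester's identity, from two triangular factorisations of the block matrix with rows
    [(1, - B)] and [(A, 1)]. It brings the determinant of [Qmx] down from size [N] to size [n]. *)
Lemma det_1_addC (A : 'M[R]_(N, n)) (B : 'M[R]_(n, N)) :
  \det (1%:M + A *m B) = \det (1%:M + B *m A).
Proof.
have E : block_mx 1%:M 0 A 1%:M *m block_mx 1%:M (- B) 0 (1%:M + A *m B) =
    block_mx (1%:M + B *m A) (- B) 0 1%:M *m block_mx 1%:M 0 A 1%:M.
  rewrite !mulmx_block !mulmx0 !mul0mx !mulmx1 !mul1mx !addr0 !add0r.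
  by rewrite mulmxN mulNmx addrK addrCA addNr addr0.
have := congr1 determinant E.
by rewrite !det_mulmx !det_ublock !det_lblock !det1 !mul1r !mulr1.
Qed.

Lemma ln_prod (I : finType) (f : I -> R) : (forall i, 0 < f i) ->
  ln (\prod_i f i) = \sum_i ln (f i).
Proof.
move=> f0; suff [] : 0 < \prod_i f i /\ ln (\prod_i f i) = \sum_i ln (f i) by [].
apply: (big_ind2 (fun x y => 0 < x /\ ln x = y)); rewrite ?ltr01 ?ln1 //.
move=> x1 x2 y1 y2 [x10 <-] [y10 <-]; split; first exact: mulr_gt0.
by rewrite lnM ?posrE.
Qed.

Lemma fnormE (x : 'cV[R]_N) : fnorm x ^+ 2 = (x^T *m x) 0 0.
Proof.
rewrite /fnorm sqr_sqrtr; last first.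
  by apply: sumr_ge0 => i _; apply: sumr_ge0 => l _; exact: sqr_ge0.
by rewrite mxE; apply: eq_bigr => i _; rewrite big_ord1 !mxE expr2.
Qed.

Variables (Phi : 'M[R]_(N, n)) (Y : 'cV[R]_N) (sigma : R).
Hypothesis sigma_gt0 : 0 < sigma.
Let v := sigma ^+ 2.
Let v0 : 0 < v. Proof. by rewrite exprn_gt0. Qed.
Variables (U : 'M[R]_n) (g : 'I_n -> R).
Hypothesis U1 : U *m U^T = 1%:M.
Hypothesis GE : Phi^T *m Phi = spec U g.
Hypothesis g0 : forall i, 0 < g i.
Let z i := (U *m (Phi^T *m Y)) i 0.
Let M h := spec U (fun i => (v + h * g i)^-1).
Let D0 h : 0 < h -> forall i, 0 < v + h * g i.
Proof. by move=> h0 i; rewrite ltr_pwDl // mulr_ge0 // ltW. Qed.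

Let QE h : Qmx sigma Phi h%:M = h *: (Phi *m Phi^T) + v%:M.
Proof. by rewrite /Qmx mul_mx_scalar scalemxAl. Qed.

Let GM h : 0 < h -> 1%:M - h *: (spec U g *m M h) = v *: M h.
Proof.
move=> h0; rewrite specM // specZ -[1%:M](spec_scalar U1) -scaleN1r specZ specD specZ.
by apply: eq_spec => i; field; rewrite gt_eqF // D0.
Qed.

(** Woodbury's identity, [M h] being the resolvent [(v + h Phi^T Phi)^-1] of size [n], which is
    diagonal in the eigenbasis of the Gram matrix. *)
Lemma Qmx_inv h : 0 < h ->
  invmx (Qmx sigma Phi h%:M) = v^-1 *: (1%:M - h *: (Phi *m M h *m Phi^T)).
Proof.
move=> h0; set X := v^-1 *: _.
have QX : Qmx sigma Phi h%:M *m X = 1%:M.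
  rewrite /X -scalemxAr QE mulmxBr mulmx1.
  have -> : (h *: (Phi *m Phi^T) + v%:M) *m (h *: (Phi *m M h *m Phi^T)) =
      h *: (Phi *m (h *: (spec U g *m M h) + v *: M h) *m Phi^T).
    rewrite -scalemxAr; congr (_ *: _).
    rewrite mulmxDl mulmxDr mulmxDl mul_scalar_mx -!scalemxAl -!scalemxAr -!scalemxAl -GE.
    by rewrite !mulmxA.
  rewrite -GM // [_ + (1%:M - _)]addrC subrK mulmx1 [X in X - _]addrC addrK.
  by rewrite -scalemx1 scalerA mulVf ?gt_eqF // scale1r.
by have [Qu _] := mulmx1_unit QX; rewrite -[LHS]mulmx1 -QX mulKmx.
Qed.

Lemma det_Qmx h : 0 < h ->
  \det (Qmx sigma Phi h%:M) = v ^+ N * \prod_i (1 + h / v * g i).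
Proof.
move=> h0; have -> : Qmx sigma Phi h%:M = v *: (1%:M + Phi *m ((h / v) *: Phi^T)).
  rewrite QE scalerDr scalemx1 addrC -scalemxAr scalerA; congr (_ + _ *: _).
  by field; rewrite gt_eqF.
rewrite detZ det_1_addC -scalemxAl GE specZ -(spec_scalar U1) specD det_spec //.
Qed.

Lemma F_EB_spec h : 0 < h ->
  F_EB sigma Phi Y h%:M = v^-1 * (Y^T *m Y) 0 0 + ln (v ^+ N) +
    \sum_i (ln (1 + h / v * g i) - v^-1 * (h * z i ^+ 2 / (v + h * g i))).
Proof.
move=> h0; rewrite /F_EB Qmx_inv // det_Qmx // lnM; last 2 first.
- by rewrite posrE exprn_gt0.
- by rewrite posrE prodr_gt0 // => i _; rewrite addr_gt0 // mulr_gt0 // divr_gt0.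
rewrite ln_prod => [|i]; last by rewrite addr_gt0 // mulr_gt0 // divr_gt0.
have -> : quad (v^-1 *: (1%:M - h *: (Phi *m M h *m Phi^T))) Y =
    v^-1 * ((Y^T *m Y) 0 0 - h * quad (M h) (Phi^T *m Y)).
  rewrite /quad -scalemxAr -scalemxAl mxE mulmxBr mulmxBl mulmx1.
  rewrite -scalemxAr -scalemxAl trmx_mul trmxK !mulmxA.
  by rewrite !mxE.
rewrite quad_spec sumrB -mulr_sumr mulrBr mulr_sumr -!addrA; congr (_ + _).
rewrite addrC -!addrA; congr (_ + (_ - _)).
congr (_ * _); apply: eq_bigr => i _.
by rewrite mulrA mulrAC.
Qed.

Lemma F_Sy_spec h : 0 < h ->
  F_Sy sigma Phi Y h%:M = (Y^T *m Y) 0 0 +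
    \sum_i (h ^+ 2 * g i * z i ^+ 2 / (v + h * g i) ^+ 2
            - 2 * (h * z i ^+ 2 / (v + h * g i))
            + 2 * v * (h * g i / (v + h * g i))).
Proof.
move=> h0; set y := Phi^T *m Y.
(* The push-through identity: both the fitted values and the trace penalty meet the large inverse
   only behind [Phi^T]. *)
have PQ : Phi^T *m invmx (Qmx sigma Phi h%:M) = M h *m Phi^T.
  have E : Phi^T *m (Phi *m M h *m Phi^T) = spec U g *m M h *m Phi^T.
    by rewrite -GE !mulmxA.
  rewrite Qmx_inv // -scalemxAr mulmxBr mulmx1 -scalemxAr E.
  rewrite -[X in X - _]mul1mx scalemxAl -mulmxBl GM // -scalemxAl scalerA.
  by rewrite mulVf ?gt_eqF // scale1r.
have MT : (M h)^T = M h by rewrite /M /spec !trmx_mul trmxK tr_diag_mx mulmxA.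
have wE : (M h *m y)^T *m y = y^T *m M h *m y by rewrite trmx_mul MT.
rewrite /F_Sy fnormE.
have -> : Phi *m thetaR sigma Phi Y h%:M = h *: (Phi *m (M h *m y)).
  by rewrite /thetaR mul_scalar_mx -!scalemxAl PQ -scalemxAr !mulmxA.
have -> : ((Y - h *: (Phi *m (M h *m y)))^T *m (Y - h *: (Phi *m (M h *m y)))) 0 0 =
    (Y^T *m Y) 0 0 - 2 * (h * quad (M h) y)
    + h ^+ 2 * quad (M h *m spec U g *m M h) y.
  rewrite [(_ - _)^T]linearB linearZ /= mulmxBr !mulmxBl -!scalemxAl -!scalemxAr.
  have -> : Y^T *m (Phi *m (M h *m y)) = y^T *m M h *m y.
    by rewrite /y trmx_mul trmxK !mulmxA.
  have -> : (Phi *m (M h *m y))^T *m Y = y^T *m M h *m y.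
    by rewrite -wE [(Phi *m _)^T]trmx_mul -mulmxA.
  have -> : (Phi *m (M h *m y))^T *m (Phi *m (M h *m y)) =
      y^T *m (M h *m spec U g *m M h) *m y.
    by rewrite [(Phi *m _)^T]trmx_mul [(M h *m y)^T]trmx_mul MT -GE !mulmxA.
  by rewrite /quad scalerA !mxE; ring.
have -> : \tr (Phi *m h%:M *m Phi^T *m invmx (Qmx sigma Phi h%:M)) =
    h * \tr (M h *m spec U g).
  rewrite -mulmxA PQ mul_mx_scalar -scalemxAl mxtraceZ mxtrace_mulC -mulmxA GE.
  by [].
rewrite -/v !specM // tr_spec // !quad_spec -!addrA; congr (_ + _).
rewrite !mulr_sumr -sumrN -!big_split /=; apply: eq_bigr => i _ /=.
by rewrite -/(z i); field; rewrite gt_eqF // D0.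
Qed.

End scalar_kernel_costs.

Section stationarity.
Context {R : realType}.

(** Fermat's rule on a ball inside [Omega]. The explicit form [f] of the cost is available for
    positive arguments only, which suffices as [Omega] contains no others. *)
Lemma argmin_stationary (Omega : set R) (F f f' : R -> R) (h : R) :
  Omega° h -> argmin Omega F h ->
  (forall t, Omega t -> 0 < t) -> (forall t, 0 < t -> F t = f t) ->
  (forall t : R, 0 < t -> is_derive t 1 f (f' t)) -> f' h = 0.
Proof.
move=> /nbhs_ballP[e /= e0 eO] [Oh hmin] O0 Ff df.
have inO (t : R) : t \in `]h - e, h + e[%R -> Omega t.
  rewrite in_itv /= => /andP[th1 th2]; apply: eO.
  by rewrite /ball /= distrC ltr_distl th1 th2.
have := @derive1_at_min _ f (h - e) (h + e) h.
have -> : h - e <= h + e by rewrite lerD2l -subr_ge0 opprK addr_ge0 // ltW.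
move=> /(_ isT).
case=> [t |||_ f'0]; first by move=> /inO/O0/df[].
- by rewrite in_itv /= ltrDl e0 ltrBlDr ltrDl e0.
- by move=> t /inO Ot; rewrite -!Ff; [exact: hmin | exact: O0 | exact: O0].
by have [_ <-] := df h (O0 _ Oh).
Qed.

Section cost_derivatives.
Context {n : nat}.
Variables (v : R) (g z : 'I_n -> R).
Hypothesis v0 : 0 < v.
Hypothesis g0 : forall i, 0 < g i.

Let D0 h : 0 < h -> forall i, 0 < v + h * g i.
Proof. by move=> h0 i; rewrite ltr_pwDl // mulr_ge0 // ltW. Qed.

Lemma is_derive_sum_fun (f : 'I_n -> R -> R) (df : 'I_n -> R) (t : R) :
  (forall i, is_derive t 1 (f i) (df i)) ->
  is_derive t 1 (fun x => \sum_i f i x) (\sum_i df i).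
Proof.
move=> /is_derive_sum; congr (is_derive _ _ _ _).
by apply/funext => x; rewrite fct_sumE.
Qed.

Lemma is_derive_EB (C h : R) : 0 < h ->
  is_derive h 1 (fun h => C +
    \sum_i (ln (1 + h / v * g i) - v^-1 * (h * z i ^+ 2 / (v + h * g i))))
    (\sum_i (g i / (v + h * g i) - z i ^+ 2 / (v + h * g i) ^+ 2)).
Proof.
move=> h0; rewrite -[X in is_derive _ _ _ X]add0r.
apply: (@is_deriveD _ _ _ (cst C)); apply: is_derive_sum_fun => i.
have Dn : v + h * g i != 0 by rewrite gt_eqF // D0.
have ln0 : 0 < 1 + h / v * g i by rewrite addr_gt0 // mulr_gt0 // divr_gt0.
have d1 : is_derive h 1 (fun h => 1 + h / v * g i) (g i / v).
  apply: is_derive_eq; rewrite /GRing.scale /=; ring.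
have d2 : is_derive h 1 (fun h => v + h * g i) (g i).
  by apply: is_derive_eq; rewrite /GRing.scale /=; ring.
have d3 := @is_deriveV _ (fun h => v + h * g i) h _ 1 Dn d2.
apply: is_deriveB.
  have := @is_derive1_comp _ (@ln R) (fun h => 1 + h / v * g i) h _ _
    (is_derive1_ln ln0) d1.
  rewrite /comp; congr (is_derive _ _ _ _); rewrite mulrC.
  by field; rewrite ?gt_eqF // mulrC // ltr_pwDl // mulr_ge0 // ltW.
apply: is_derive_eq; rewrite /GRing.scale /=.
by field; rewrite Dn ?gt_eqF.
Qed.

Lemma is_derive_Sy (C h : R) : 0 < h ->
  is_derive h 1 (fun h => C +
    \sum_i (h ^+ 2 * g i * z i ^+ 2 / (v + h * g i) ^+ 2
            - 2 * (h * z i ^+ 2 / (v + h * g i))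
            + 2 * v * (h * g i / (v + h * g i))))
    (\sum_i (2 * v ^+ 2) * (g i / (v + h * g i) ^+ 2
                            - z i ^+ 2 / (v + h * g i) ^+ 3)).
Proof.
move=> h0; rewrite -[X in is_derive _ _ _ X]add0r.
apply: (@is_deriveD _ _ _ (cst C)); apply: is_derive_sum_fun => i.
have Dn : v + h * g i != 0 by rewrite gt_eqF // D0.
have d2 : is_derive h 1 (fun h => v + h * g i) (g i).
  by apply: is_derive_eq; rewrite /GRing.scale /=; ring.
have d3 := @is_deriveV _ (fun h => v + h * g i) h _ 1 Dn d2.
have d4 := is_deriveX 2 d2.
have Dn2 : (v + h * g i) ^+ 2 != 0 by rewrite expf_neq0.
have d5 := @is_deriveV _ (fun h => (v + h * g i) ^+ 2) h _ 1 Dn2 d4.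
apply: is_derive_eq; rewrite /GRing.scale /=.
by field; rewrite Dn ?gt_eqF.
Qed.

End cost_derivatives.
End stationarity.

(** * Two-sided bounds on the roots of the stationarity equations *)

Section estimator_bounds.
Context {R : realType}.

Lemma ler_invX (a b : R) k : 0 < a -> a <= b -> (b ^+ k)^-1 <= (a ^+ k)^-1.
Proof.
move=> a0 ab; have b0 := lt_le_trans a0 ab.
by rewrite lef_pV2 ?posrE ?exprn_gt0 // lerXn2r // nnegrE; exact: ltW.
Qed.

(** Replacing the [s i] by the extremes 0, [e] and [tau] gives [n / (h + tau) <= Q / h^2] and
    [Q / (h + tau)^2 <= n / (h + e)], where [Q] is the sum of the [th2 i]. It remains that
    [h^2 / (h + tau) >= h - tau] and [(h + tau)^2 / (h + e) <= h + 2 tau + tau^2 / e]. Nothing keeps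
    [h] away from 0 or infinity, so the error must not depend on [h]. *)
Lemma EB_root_bounds n (h e tau : R) (s th2 : 'I_n -> R) : (0 < n)%N ->
  0 < h -> 0 < e -> (forall i, e <= s i <= tau) -> (forall i, 0 <= th2 i) ->
  \sum_i (h + s i)^-1 = \sum_i th2 i / (h + s i) ^+ 2 ->
  h - tau <= (\sum_i th2 i) / n%:R <= h + (2 * tau + tau ^+ 2 / e).
Proof.
move=> n0 h0 e0 se t0 foc.
have nR : 0 < n%:R :> R by rewrite ltr0n.
have etau : e <= tau.
  by have /andP[] := se (Ordinal n0); exact: le_trans.
have tau0 : 0 < tau by exact: lt_le_trans etau.
have s0 i : 0 < s i by have /andP[+ _] := se i; exact: lt_le_trans.
have hs0 i : 0 < h + s i by exact: addr_gt0.
have cstE (a : R) : \sum_(i < n) a = n%:R * a by rewrite sumr_const card_ord mulr_natl.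
set Q := \sum_i th2 i.
have Q0 : 0 <= Q by apply: sumr_ge0.
apply/andP; split.
  have : n%:R / (h + tau) <= Q / h ^+ 2.
    rewrite -cstE /Q mulr_suml (le_trans (_ : _ <= \sum_i (h + s i)^-1)) //.
      apply: ler_sum => i _; rewrite lef_pV2 ?posrE ?addr_gt0 // lerD2l.
      by have /andP[] := se i.
    rewrite foc; apply: ler_sum => i _; rewrite ler_wpM2l //.
    by rewrite ler_invX // lerDl ltW.
  rewrite ler_pdivrMr ?addr_gt0 // mulrAC ler_pdivlMr ?exprn_gt0 // => H.
  rewrite ler_pdivlMr // -(@ler_pM2r _ (h + tau)) ?addr_gt0 //.
  apply: le_trans H; rewrite mulrAC [leRHS]mulrC ler_wpM2r ?(ltW nR) // -subr_ge0.
  have -> : h ^+ 2 - (h - tau) * (h + tau) = tau ^+ 2 by ring.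
  exact: sqr_ge0.
have : Q / (h + tau) ^+ 2 <= n%:R / (h + e).
  rewrite -cstE /Q mulr_suml (le_trans (_ : _ <= \sum_i th2 i / (h + s i) ^+ 2)) //.
    apply: ler_sum => i _; rewrite ler_wpM2l // ler_invX // lerD2l.
    by have /andP[] := se i.
  rewrite -foc; apply: ler_sum => i _.
  by rewrite lef_pV2 ?posrE ?addr_gt0 // lerD2l; have /andP[] := se i.
rewrite ler_pdivrMr ?exprn_gt0 ?addr_gt0 // => H.
rewrite ler_pdivrMr // (le_trans H) // mulrAC -mulrA mulrC ler_wpM2r ?(ltW nR) //.
rewrite ler_pdivrMr ?addr_gt0 // -subr_ge0.
have -> : (h + (2 * tau + tau ^+ 2 / e)) * (h + e) - (h + tau) ^+ 2 =
  h * tau ^+ 2 / e + e * h + 2 * tau * e by field; rewrite gt_eqF.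
by rewrite !addr_ge0 ?mulr_ge0 ?divr_ge0 ?mulr_ge0 ?exprn_ge0 ?invr_ge0 ?ltW.
Qed.

(** The same comparison for a mean with weights [k i], now through [h^3 / (h + tau)^2 >= h - 2 tau]
    and the expansion of [(h + tau)^3 / (h + e)^2]. *)
Lemma Sy_root_bounds n (h e tau : R) (s k th2 : 'I_n -> R) : (0 < n)%N ->
  0 < h -> 0 < e -> (forall i, e <= s i <= tau) -> (forall i, 0 <= th2 i) ->
  (forall i, 0 < k i) ->
  \sum_i k i / (h + s i) ^+ 2 = \sum_i k i * th2 i / (h + s i) ^+ 3 ->
  h - 2 * tau <= (\sum_i k i * th2 i) / (\sum_i k i)
    <= h + (3 * tau + 3 * tau ^+ 2 / e + tau ^+ 3 / e ^+ 2).
Proof.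
move=> n0 h0 e0 se t0 k0 foc.
have etau : e <= tau.
  by have /andP[] := se (Ordinal n0); exact: le_trans.
have tau0 : 0 < tau by exact: lt_le_trans etau.
have s0 i : 0 < s i by have /andP[+ _] := se i; exact: lt_le_trans.
have hs0 i : 0 < h + s i by exact: addr_gt0.
set A := \sum_i k i * th2 i; set t := \sum_i k i.
have A0 : 0 <= A by apply: sumr_ge0 => i _; rewrite mulr_ge0 // ltW.
have tt0 : 0 < t.
  rewrite /t (bigD1 (Ordinal n0)) //= ltr_pwDl //.
  by apply: sumr_ge0 => i _; rewrite ltW.
apply/andP; split.
  have : t / (h + tau) ^+ 2 <= A / h ^+ 3.
    rewrite /t /A !mulr_suml (le_trans (_ : _ <= \sum_i k i / (h + s i) ^+ 2)) //.
      apply: ler_sum => i _; rewrite ler_wpM2l ?(ltW (k0 i)) //.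
      by rewrite ler_invX // lerD2l; have /andP[] := se i.
    rewrite foc; apply: ler_sum => i _; rewrite ler_wpM2l ?mulr_ge0 ?(ltW (k0 i)) //.
    by rewrite ler_invX // lerDl ltW.
  rewrite ler_pdivrMr ?exprn_gt0 ?addr_gt0 // mulrAC ler_pdivlMr ?exprn_gt0 // => H.
  rewrite ler_pdivlMr // -(@ler_pM2r _ ((h + tau) ^+ 2)) ?exprn_gt0 ?addr_gt0 //.
  apply: le_trans H; rewrite mulrAC [leRHS]mulrC ler_wpM2r ?(ltW tt0) // -subr_ge0.
  have -> : h ^+ 3 - (h - 2 * tau) * (h + tau) ^+ 2 = 3 * h * tau ^+ 2 + 2 * tau ^+ 3 by ring.
  by rewrite !addr_ge0 ?mulr_ge0 ?exprn_ge0 ?ltW.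
have : A / (h + tau) ^+ 3 <= t / (h + e) ^+ 2.
  rewrite /t /A !mulr_suml (le_trans (_ : _ <= \sum_i k i * th2 i / (h + s i) ^+ 3)) //.
    apply: ler_sum => i _; rewrite ler_wpM2l ?mulr_ge0 ?(ltW (k0 i)) //.
    by rewrite ler_invX // lerD2l; have /andP[] := se i.
  rewrite -foc; apply: ler_sum => i _; rewrite ler_wpM2l ?(ltW (k0 i)) //.
  by rewrite ler_invX ?addr_gt0 // lerD2l; have /andP[] := se i.
rewrite ler_pdivrMr ?exprn_gt0 ?addr_gt0 // mulrAC ler_pdivlMr ?exprn_gt0 ?addr_gt0 // => H.
rewrite ler_pdivrMr // -(@ler_pM2r _ ((h + e) ^+ 2)) ?exprn_gt0 ?addr_gt0 //.
apply: (le_trans H); rewrite [leRHS]mulrAC [leLHS]mulrC ler_wpM2r ?(ltW tt0) // -subr_ge0.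
have -> : (h + (3 * tau + 3 * tau ^+ 2 / e + tau ^+ 3 / e ^+ 2)) * (h + e) ^+ 2
    - (h + tau) ^+ 3 =
  2 * h ^+ 2 * e + h * e ^+ 2 + 3 * h ^+ 2 * tau ^+ 2 / e + h ^+ 2 * tau ^+ 3 / e ^+ 2 +
  6 * h * e * tau + 3 * h * tau ^+ 2 + 2 * h * tau ^+ 3 / e + 3 * tau * e ^+ 2 +
  3 * tau ^+ 2 * e.
  by field; rewrite gt_eqF.
by rewrite !addr_ge0 ?mulr_ge0 ?divr_ge0 ?mulr_ge0 ?exprn_ge0 ?invr_ge0 ?ltW ?exprn_gt0.
Qed.

End estimator_bounds.

Section estimator_close.
Context {R : realType} {N n : nat}.
Variables (Phi : 'M[R]_(N, n)) (Y : 'cV[R]_N) (sigma : R) (Omega : set R) (h : R).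
Hypotheses (sigma_gt0 : 0 < sigma) (n0 : (0 < n)%N).
Hypothesis Gu : Phi^T *m Phi \in unitmx.
Hypothesis Omega_gt0 : forall t, Omega t -> 0 < t.
Hypothesis Oh : Omega° h.
Let G := Phi^T *m Phi.
Let K := invmx G.
Let th := K *m (Phi^T *m Y).
Let v := sigma ^+ 2.
(** All [v / g i] lie between [v / \tr G] and [tau], and [rho] is the quotient of these two bounds.
    Traces stand in for the extreme eigenvalues because they pass to limits entrywise; moreover
    [rho] does not change when [G] is divided by [N]. *)
Let tau := v * \tr K.
Let rho := \tr G * \tr K.

Lemma gram_spec : exists U g, [/\ U *m U^T = 1%:M, G = spec U g & forall i, 0 < g i].
Proof.
have Gsym : G^T = G by rewrite /G trmx_mul trmxK.
have [U [g [U1 GE]]] := spec_exists Gsym; exists U, g; split => // i.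
have gi : g i = \sum_k ((Phi *m U^T) k i) ^+ 2.
  have : (U *m G *m U^T) i i = g i.
    rewrite GE /spec !mulmxA U1 mul1mx -mulmxA U1 mulmx1 !mxE eqxx mulr1n //.
  move=> <-; have -> : U *m G *m U^T = (Phi *m U^T)^T *m (Phi *m U^T).
    by rewrite trmx_mul trmxK /G !mulmxA.
  by rewrite [LHS]mxE; apply: eq_bigr => k _; rewrite [_^T _ _]mxE expr2.
have ge0 : 0 <= g i by rewrite gi; apply: sumr_ge0 => k _; exact: sqr_ge0.
rewrite lt_neqAle ge0 andbT eq_sym.
have : \det G != 0 by rewrite -unitfE -unitmxE.
by rewrite GE det_spec // => /prodf_neq0; apply.
Qed.

Lemma gram_spectrum : exists U g, [/\ U *m U^T = 1%:M, G = spec U g,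
  forall i, 0 < g i &
  [/\ K = spec U (fun i => (g i)^-1),
    forall i, (U *m th) i 0 = (U *m (Phi^T *m Y)) i 0 / g i,
    0 < \tr G, 0 < \tr K & forall i, v / \tr G <= v / g i <= tau]].
Proof.
have [U [g [U1 GE g0]]] := gram_spec.
have v0 : 0 < v by rewrite exprn_gt0.
have gN0 i : g i != 0 by rewrite gt_eqF.
have KE : K = spec U (fun i => (g i)^-1) by rewrite /K GE spec_inv.
have trK : \tr K = \sum_i (g i)^-1 by rewrite KE tr_spec.
have trG : \tr G = \sum_i g i by rewrite GE tr_spec.
have trG0 : 0 < \tr G.
  rewrite trG (bigD1 (Ordinal n0)) //= ltr_pwDl //.
  by apply: sumr_ge0 => i _; rewrite ltW.
have trK0 : 0 < \tr K.
  rewrite trK (bigD1 (Ordinal n0)) //= ltr_pwDl // ?invr_gt0 //.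
  by apply: sumr_ge0 => i _; rewrite invr_ge0 ltW.
exists U, g; split => //; split => // i.
  rewrite /th KE /spec !mulmxA U1 mul1mx -!mulmxA mul_diag_mx mulrC.
  by move: (U *m _) => w; rewrite !mxE.
rewrite /tau !ler_pM2l // lef_pV2 ?posrE // trG trK.
by apply/andP; split; rewrite (bigD1 i) //= lerDl; apply: sumr_ge0 => j _;
  rewrite ?invr_ge0 ltW.
Qed.

Lemma EB_estimator_bound :
  argmin Omega (fun eta => F_EB sigma Phi Y eta%:M) h ->
  `|h - (th^T *m th) 0 0 / n%:R| <= tau * (2 + rho).
Proof.
move=> hmin; have [U [g [U1 GE g0 [KE thE trG0 trK0 se]]]] := gram_spectrum.
have v0 : 0 < v by rewrite exprn_gt0.
have h0 : 0 < h by case: hmin => /Omega_gt0.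
pose z i := (U *m (Phi^T *m Y)) i 0.
have foc := argmin_stationary Oh hmin Omega_gt0
  (fun t => @F_EB_spec _ _ _ Phi Y sigma sigma_gt0 U g U1 GE g0 t)
  (@is_derive_EB _ _ v g z v0 g0 _).
have e0 : 0 < v / \tr G by rewrite divr_gt0.
have foc' : \sum_i (h + v / g i)^-1 = \sum_i (z i / g i) ^+ 2 / (h + v / g i) ^+ 2.
  apply/eqP; rewrite -subr_eq0 -sumrB -[X in _ == X]foc; apply/eqP => /=.
  apply: eq_bigr => i _.
  have Dn : 0 < v + h * g i by rewrite ltr_pwDl // mulr_ge0 // ltW.
  by field; rewrite !gt_eqF //= addrC.
have := EB_root_bounds n0 h0 e0 se (fun i => sqr_ge0 _) foc'.
have -> : \sum_i (z i / g i) ^+ 2 = (th^T *m th) 0 0.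
  by rewrite -(sum_sqr_spec U1); apply: eq_bigr => i _; rewrite thE.
have -> : tau ^+ 2 / (v / \tr G) = tau * rho.
  by rewrite /tau /rho; field; rewrite !gt_eqF.
have tau0 : 0 < tau by rewrite mulr_gt0.
have : 0 <= tau * rho by rewrite mulr_ge0 ?mulr_ge0 // ltW.
by rewrite ler_norml; lra.
Qed.

Lemma Sy_estimator_bound :
  argmin Omega (fun eta => F_Sy sigma Phi Y eta%:M) h ->
  `|h - quad K th / \tr K| <= tau * (3 + 3 * rho + rho ^+ 2).
Proof.
move=> hmin; have [U [g [U1 GE g0 [KE thE trG0 trK0 se]]]] := gram_spectrum.
have v0 : 0 < v by rewrite exprn_gt0.
have h0 : 0 < h by case: hmin => /Omega_gt0.
pose z i := (U *m (Phi^T *m Y)) i 0.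
have foc := argmin_stationary Oh hmin Omega_gt0
  (fun t => @F_Sy_spec _ _ _ Phi Y sigma sigma_gt0 U g U1 GE g0 t)
  (@is_derive_Sy _ _ v g z v0 g0 _).
have e0 : 0 < v / \tr G by rewrite divr_gt0.
have foc' : \sum_i (g i)^-1 / (h + v / g i) ^+ 2 =
    \sum_i (g i)^-1 * (z i / g i) ^+ 2 / (h + v / g i) ^+ 3.
  apply: (mulfI (_ : 2 * v ^+ 2 != 0)).
    by rewrite gt_eqF // mulr_gt0 // exprn_gt0.
  apply/eqP; rewrite -subr_eq0 -mulrBr -sumrB mulr_sumr -[X in _ == X]foc.
  apply/eqP => /=.
  apply: eq_bigr => i _.
  have Dn : 0 < v + h * g i by rewrite ltr_pwDl // mulr_ge0 // ltW.
  by field; rewrite !gt_eqF //= addrC.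
have ginv i : 0 < (g i)^-1 by rewrite invr_gt0.
have := Sy_root_bounds n0 h0 e0 se (fun i => sqr_ge0 _) ginv foc'.
have -> : \sum_i (g i)^-1 * (z i / g i) ^+ 2 = quad K th.
  by rewrite [in RHS]KE quad_spec; apply: eq_bigr => i _; rewrite thE.
have -> : \sum_i (g i)^-1 = \tr K by rewrite KE tr_spec.
have -> : 3 * tau ^+ 2 / (v / \tr G) = 3 * (tau * rho).
  by rewrite /tau /rho; field; rewrite !gt_eqF.
have -> : tau ^+ 3 / (v / \tr G) ^+ 2 = tau * rho ^+ 2.
  by rewrite /tau /rho; field; rewrite !gt_eqF.
have tau0 : 0 < tau by rewrite mulr_gt0.
have : 0 <= tau * rho by rewrite mulr_ge0 ?mulr_ge0 // ltW.
have : 0 <= tau * rho ^+ 2 by rewrite mulr_ge0 ?sqr_ge0 // ltW.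
by rewrite ler_norml; lra.
Qed.

End estimator_close.

(** * Linear combinations of Gaussian noise *)

Section gaussian_convolution.
Context {R : realType}.
Local Notation mu := (@lebesgue_measure R).
Local Notation pdf s := (normal_pdf (0 : R) s).

Definition affine (a b : R) (x : R) : measurableTypeR R := a * x + b.

Lemma measurable_affine (a b : R) : measurable_fun [set: R] (affine a b).
Proof. by apply: measurable_funD => //; exact: measurable_funM. Qed.

HB.instance Definition _ a b :=
  isMeasurableFun.Build _ _ (measurableTypeR R) _ (affine a b) (measurable_affine a b).

Lemma lebesgue_measure_affine (a b : R) (A : set (measurableTypeR R)) : a != 0 ->
  measurable A -> (`|a|%:E * pushforward mu (affine a b) A = mu A)%E.
Proof.
move=> a0 mA; apply/esym.
pose m' := mscale (NngNum (normr_ge0 a)) (pushforward mu (affine a b)).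
rewrite -[RHS]/(m' (measurable_affine a b) A).
apply: lebesgue_measure_unique mA => _ [[x y] _ <-].
rewrite -[RHS]/(`|a|%:E * mu (affine a b @^-1` `]x, y]))%E.
have [a_gt0|a_lt0|a00] := ltgtP 0 a; last by rewrite a00 eqxx in a0.
  rewrite (_ : _ @^-1` _ = `](x - b) / a, (y - b) / a]%classic); last first.
    apply/seteqP; split=> z /=; rewrite !in_itv /= /affine ltr_pdivrMr // ler_pdivlMr //;
    by rewrite ltrBlDr lerBrDr mulrC.
  rewrite !lebesgue_measure_itv /= !lte_fin ltr_pM2r ?invr_gt0 // ltrD2r.
  case: ifP => xy; last by rewrite mule0.
  by rewrite gtr0_norm // -!EFinD -EFinM; congr (_%:E); field; rewrite gt_eqF.
(* A negative slope moves the closed end of the interval to the left, which leaves its length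
   unchanged. *)
rewrite (_ : _ @^-1` _ = `[(y - b) / a, (x - b) / a[%classic); last first.
  apply/seteqP; split=> z /=; rewrite !in_itv /= /affine ltr_ndivlMr // ler_ndivrMr //;
  by rewrite ltrBlDr lerBrDr mulrC andbC.
rewrite !lebesgue_measure_itv /= !lte_fin ltr_nM2r ?invr_lt0 // ltrD2r.
case: ifP => xy; last by rewrite mule0.
by rewrite ltr0_norm // -!EFinD -EFinM; congr (_%:E); field; rewrite lt_eqF.
Qed.

Lemma ge0_integral_affine (a b : R) (f : R -> \bar R) : a != 0 ->
  measurable_fun [set: R] f -> (forall x, 0 <= f x)%E ->
  (\int[mu]_x f x = `|a|%:E * \int[mu]_x f (affine a b x))%E.
Proof.
move=> a0 mf f0; have maff := measurable_affine a b.
have -> : (\int[mu]_x f (affine a b x) = \int[pushforward mu (affine a b)]_x f x)%E.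
  by rewrite ge0_integral_pushforward.
have := @ge0_integral_mscale _ _ _ (pushforward mu (affine a b)) setT measurableT
  (NngNum (normr_ge0 a)) f.
move=> <- //.
by apply: eq_measure_integral => A mA _; symmetry; exact: (lebesgue_measure_affine b a0 mA).
Qed.

(** The Radon-Nikodym derivative of the normal law agrees almost everywhere with its density, since
    both have the same integral over each measurable set. *)
Lemma integral_normal_prob (s : R) (f : R -> \bar R) :
  measurable_fun setT f -> (\int[normal_prob 0 s]_x `|f x| < +oo)%E ->
  (\int[normal_prob 0 s]_x f x = \int[mu]_x (f x * (pdf s x)%:E))%E.
Proof.
move=> mf finf.
rewrite -(Radon_Nikodym_change_of_variables (normal_prob_dominates 0 s))//=; last first.
  by apply/integrableP; split.
apply: ae_eq_integral => //.
- apply: emeasurable_funM => //; apply: (measurable_int mu).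
  by apply: Radon_Nikodym_integrable; exact: normal_prob_dominates.
- apply: emeasurable_funM => //=; apply/measurableT_comp => //=.
  exact: measurable_normal_pdf.
- apply: ae_eqe_mul2l => /=.
  rewrite Radon_NikodymE//=; first exact: normal_prob_dominates.
  move=> dom; case: cid => /= h [h1 h2 h3].
  apply: integral_ae_eq => //=.
  + by apply/measurableT_comp => //; exact: measurable_normal_pdf.
  + by move=> E E01 mE; rewrite -h3.
Qed.

(** Completing the square in [x]: the joint density of a summand and the sum is the density of the
    sum at [w] times the conditional density of the summand, of mean [w s^2 / r^2] and standard
    deviation [s t / r]. *)
Lemma normal_pdf_mul (s t r x w : R) : s != 0 -> t != 0 -> r ^+ 2 = s ^+ 2 + t ^+ 2 ->
  pdf s x * pdf t (w - x) =
  pdf r w * normal_pdf (w * s ^+ 2 / r ^+ 2) (s * t / r) x.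
Proof.
move=> s0 t0 rE.
have r20 : 0 < r ^+ 2 by rewrite rE addr_gt0 // exprn_even_gt0.
have r0 : r != 0 by rewrite -sqrf_eq0 gt_eqF.
have q0 : s * t / r != 0 by rewrite !mulf_neq0 // invr_eq0.
have pdfE (m a y : R) : a != 0 -> normal_pdf m a y = normal_peak a * normal_fun m a y.
  by move=> a0; rewrite normal_pdfE.
rewrite !pdfE // /normal_fun.
have -> : normal_peak s * expR (- (x - 0) ^+ 2 / (s ^+ 2 *+ 2)) *
    (normal_peak t * expR (- (w - x - 0) ^+ 2 / (t ^+ 2 *+ 2))) =
  normal_peak s * normal_peak t * expR (- (x - 0) ^+ 2 / (s ^+ 2 *+ 2)
    + - (w - x - 0) ^+ 2 / (t ^+ 2 *+ 2)) by rewrite expRD; ring.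
have -> : normal_peak r * expR (- (w - 0) ^+ 2 / (r ^+ 2 *+ 2)) *
    (normal_peak (s * t / r) *
      expR (- (x - w * s ^+ 2 / r ^+ 2) ^+ 2 / ((s * t / r) ^+ 2 *+ 2))) =
  normal_peak r * normal_peak (s * t / r) * expR (- (w - 0) ^+ 2 / (r ^+ 2 *+ 2)
    + - (x - w * s ^+ 2 / r ^+ 2) ^+ 2 / ((s * t / r) ^+ 2 *+ 2)).
  by rewrite expRD; ring.
have st20 : s ^+ 2 + t ^+ 2 != 0 by rewrite -rE gt_eqF.
congr (_ * expR _); last first.
  have -> : (s * t / r) ^+ 2 = s ^+ 2 * t ^+ 2 / (s ^+ 2 + t ^+ 2) by rewrite -rE; field.
  rewrite rE; field.
  by rewrite s0 t0 st20.
rewrite /normal_peak -!invfM -!sqrtrM; last 2 first.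
- by rewrite pmulrn_lge0 // mulr_ge0 ?pi_ge0 // sqr_ge0.
- by rewrite pmulrn_lge0 // mulr_ge0 ?pi_ge0 // sqr_ge0.
by congr (Num.sqrt _)^-1; field.
Qed.

(** After the translation [w = x + y] and Tonelli's theorem, the conditional density of [x] given
    [w] integrates to 1. *)
Lemma normal_prob_conv (s t r : R) (A : set R) : s != 0 -> t != 0 ->
  r ^+ 2 = s ^+ 2 + t ^+ 2 -> measurable A ->
  (\int[normal_prob 0 s]_x normal_prob 0 t [set y | A (x + y)%R] = normal_prob 0 r A)%E.
Proof.
move=> s0 t0 rE mA.
have r0 : r != 0 by rewrite -sqrf_eq0 rE gt_eqF // addr_gt0 // exprn_even_gt0.
have mD : measurable_fun setT
    (fun xy : measurableTypeR R * measurableTypeR R => xy.1 + xy.2 : measurableTypeR R).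
  by apply: measurable_funD.
pose D := [set xy : measurableTypeR R * measurableTypeR R | A (xy.1 + xy.2)].
have xsD x : xsection D x = [set y : R | A (x + y)].
  by apply/seteqP; split => y /=; [move=> /set_mem|move=> ?; exact/mem_set].
have mDs : measurable D by rewrite -[D]setTI; exact: mD.
have mpre x : measurable [set y : R | A (x + y)].
  by rewrite -xsD; exact: measurable_xsection.
have gm x : measurable_fun setT (fun w : R => (\1_A w * pdf t (w - x))%:E).
  apply/measurable_EFinP/measurable_funM; first exact: measurable_indic.
  apply: (measurableT_comp (measurable_normal_pdf 0 t)).
  exact: measurable_funB.
have g0 x (w : R) : (0 <= (\1_A w * pdf t (w - x))%:E)%E.
  by rewrite lee_fin mulr_ge0 ?normal_pdf_ge0.
have restrictE m a (w : R) : (\1_A w * normal_pdf m a w)%:E =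
    ((fun x : R => (normal_pdf m a x)%:E) \_ A) w.
  by rewrite patchE indicE; case: ifP => _; rewrite ?mul1r ?mul0r.
have E1 x : (normal_prob 0 t [set y | A (x + y)%R] =
    \int[mu]_w (\1_A w * pdf t (w - x))%:E)%E.
  rewrite (@ge0_integral_affine 1 x) ?oner_neq0 //.
  rewrite normr1 mul1e /normal_prob integral_mkcond; apply: eq_integral => y _.
  rewrite /affine mul1r addrK patchE indicE addrC.
  have -> : (y \in [set y | A (x + y)]) = (x + y \in A).
    by apply/idP/idP => /set_mem ?; exact/mem_set.
  by case: ifP => _; rewrite ?mul1r ?mul0r.
have mx : measurable_fun setT (fun x : R => normal_prob 0 t [set y | A (x + y)%R]).
  have -> : (fun x : R => normal_prob 0 t [set y | A (x + y)%R]) =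
      normal_prob 0 t \o xsection D.
    by apply/funext => x /=; rewrite xsD.
  exact: measurable_fun_xsection.
rewrite integral_normal_prob //; last first.
  apply: (@le_lt_trans _ _ (\int[normal_prob 0 s]_x cst 1%E x)%E).
    apply: ge0_le_integral => //=; first exact: measurableT_comp.
    by move=> x _; rewrite gee0_abs // probability_le1 //; exact: mpre.
  rewrite integral_cst // mul1e.
  by apply: (@le_lt_trans _ _ 1%E); [exact: probability_le1|exact: ltry].
transitivity (\int[mu]_x \int[mu]_w (\1_A w * (pdf s x * pdf t (w - x)))%:E)%E.
  apply: eq_integral => x _; rewrite E1.
  rewrite -ge0_integralZr //; [|exact: gm|by rewrite lee_fin normal_pdf_ge0].
  by apply: eq_integral => w _; rewrite -EFinM; congr (_%:E); ring.
pose F (xw : measurableTypeR R * measurableTypeR R) :=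
  (\1_A xw.2 * (pdf s xw.1 * pdf t (xw.2 - xw.1)))%:E.
have mF : measurable_fun setT F.
  apply/measurable_EFinP/measurable_funM.
    by apply: (measurableT_comp (measurable_indic mA)).
  apply: measurable_funM.
    by apply: (measurableT_comp (measurable_normal_pdf 0 s)).
  apply: (measurableT_comp (measurable_normal_pdf 0 t)).
  exact: measurable_funB.
have F0 xw : (0 <= F xw)%E by rewrite lee_fin !mulr_ge0 ?normal_pdf_ge0.
rewrite [LHS](fubini_tonelli F mF F0) /F /=.
rewrite /normal_prob [RHS]integral_mkcond; apply: eq_integral => w _.
under eq_integral do rewrite (normal_pdf_mul _ _ s0 t0 rE) mulrA EFinM.
rewrite ge0_integralZl //.
- by rewrite integral_normal_pdf mule1 restrictE.
- by apply/measurable_EFinP; exact: measurable_normal_pdf.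
- by move=> x _; rewrite lee_fin normal_pdf_ge0.
- by rewrite lee_fin mulr_ge0 ?normal_pdf_ge0.
Qed.

End gaussian_convolution.

Section gaussian_linear_combination.
Context {R : realType}.
Local Notation mu := (@lebesgue_measure R).
Local Notation pdf s := (normal_pdf (0 : R) s).

Lemma normal_prob_scale (c s : R) (A : set R) : c != 0 -> s != 0 -> measurable A ->
  normal_prob 0 s [set y | A (c * y)] = normal_prob 0 (c * s) A.
Proof.
move=> c0 s0 mA; have cs0 : c * s != 0 by rewrite mulf_neq0.
have m1 : measurable_fun setT (fun w : R => (\1_A w * pdf (c * s) w)%:E).
  apply/measurable_EFinP/measurable_funM; first exact: measurable_indic.
  exact: measurable_normal_pdf.
rewrite /normal_prob integral_mkcond [RHS]integral_mkcond.
transitivity (\int[mu]_w (\1_A w * pdf (c * s) w)%:E)%E; last first.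
  by apply: eq_integral => w _; rewrite patchE indicE; case: ifP => _;
    rewrite ?mul1r ?mul0r.
rewrite (@ge0_integral_affine _ c 0) //; last first.
  by move=> x; rewrite lee_fin mulr_ge0 ?normal_pdf_ge0.
rewrite -ge0_integralZl //; last 2 first.
- exact: (measurableT_comp m1 (measurable_affine c 0)).
- by move=> x _; rewrite lee_fin mulr_ge0 ?normal_pdf_ge0.
apply: eq_integral => y _; rewrite -EFinM /affine addr0 patchE indicE.
have -> : (y \in [set y | A (c * y)]) = (c * y \in A).
  by apply/idP/idP => /set_mem ?; exact/mem_set.
case: ifP => _; last by rewrite mul0r mulr0.
have pdfE (a z : R) : a != 0 -> pdf a z = normal_peak a * normal_fun 0 a z.
  by move=> a0; rewrite normal_pdfE.
rewrite mul1r !pdfE //; congr (_%:E); rewrite mulrA; congr (_ * _).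
  have -> : normal_peak (c * s) = `|c|^-1 * normal_peak s.
    have -> : (normal_peak (c * s) = (Num.sqrt (c ^+ 2 * (s ^+ 2 * pi *+ 2)))^-1).
      by rewrite /normal_peak; congr (Num.sqrt _)^-1; ring.
    by rewrite sqrtrM ?sqr_ge0 // sqrtr_sqr invfM.
  by rewrite mulrA divff ?mul1r // normr_eq0.
rewrite /normal_fun !subr0; congr (expR _); rewrite !exprMn; field.
by rewrite c0 s0.
Qed.

(** Scaling by a negative coefficient produces a negative deviation parameter; the law sees only its
    square. *)
Lemma normal_prob_sqr (s t : R) : s ^+ 2 = t ^+ 2 -> s != 0 ->
  normal_prob 0 s = normal_prob 0 t.
Proof.
move=> st s0; have t0 : t != 0 by rewrite -sqrf_eq0 -st sqrf_eq0.
have pdfE (a z : R) : a != 0 -> pdf a z = normal_peak a * normal_fun 0 a z.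
  by move=> a0; rewrite normal_pdfE.
apply/funext => A; apply: eq_integral => x _; congr (_%:E).
by rewrite !pdfE // /normal_peak /normal_fun st.
Qed.

Context {d : measure_display} {T : measurableType d} (Pr : probability T R).

Lemma normal_linear_combination N (V : 'I_N -> {RV Pr >-> R}) (sigma : R)
    (c : 'I_N -> R) (A : set R) : sigma != 0 ->
  (forall i B, measurable B -> distribution Pr (V i) B = normal_prob 0 sigma B) ->
  mutually_independent V -> \sum_i c i ^+ 2 = 1 -> measurable A ->
  Pr [set w | A (\sum_i c i * V i w)] = normal_prob 0 sigma A.
Proof.
move=> s0 Vlaw Vind c1 mA0.
(* [normal_prob 0 0] is uniform on [0, 1] in the library, not a Dirac mass. *)
pose law (r : R) : probability (measurableTypeR R) R :=
  if r == 0 then (\d_(0 : measurableTypeR R) : probability (measurableTypeR R) R)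
  else (normal_prob 0 (r * sigma) : probability (measurableTypeR R) R).
have lawN r0 : r0 != 0 ->
    law r0 = (normal_prob 0 (r0 * sigma) : probability (measurableTypeR R) R).
  by rewrite /law => /negbTE ->.
have law0 : law 0 = (\d_(0 : measurableTypeR R) : probability (measurableTypeR R) R).
  by rewrite /law eqxx.
pose S (k : nat) w := \sum_(i < N | (i < k)%N) c i * V i w.
pose r (k : nat) := Num.sqrt (\sum_(i < N | (i < k)%N) c i ^+ 2).
have r2 k : r k ^+ 2 = \sum_(i < N | (i < k)%N) c i ^+ 2.
  by rewrite sqr_sqrtr //; apply: sumr_ge0 => i _; exact: sqr_ge0.
have mS k : measurable_fun setT (S k : T -> measurableTypeR R).
  rewrite /S; under eq_fun do rewrite big_mkcond /=.
  apply: measurable_sum => i; case: (i < k)%N => //.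
  exact: measurable_funM.
have mV i (B : set R) : measurable B -> measurable (V i @^-1` B).
  by move=> mB; rewrite -[_ @^-1` _]setTI; exact: (measurable_funP (V i)).
have mE (B : 'I_N -> set R) : (forall i, measurable (B i)) ->
    measurable (\bigcap_i (V i @^-1` B i)).
  by move=> mB; apply: fin_bigcap_measurable => // i _; exact: mV.
(* Carrying arbitrary events on the remaining coordinates along the induction
   makes the partial sum independent of the next summand. *)
suff claim k : (k <= N)%N -> forall (A : set R) (B : 'I_N -> set R), measurable A ->
    (forall i, measurable (B i)) -> (forall i : 'I_N, (i < k)%N -> B i = setT) ->
    Pr ([set w | A (S k w)] `&` \bigcap_i (V i @^-1` B i)) =
    (law (r k) A * Pr (\bigcap_i (V i @^-1` B i)))%E.
  have := claim N (leqnn N) A (fun=> setT) mA0 (fun=> measurableT) (fun _ _ => erefl).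
  have -> : \bigcap_(i in [set: 'I_N]) (V i @^-1` setT) = setT.
    by apply/seteqP; split.
  rewrite setIT probability_setT mule1.
  have -> : r N = 1.
    by rewrite /r (eq_bigl xpredT) ?c1 ?sqrtr1 // => i; rewrite ltn_ord.
  rewrite lawN ?oner_neq0 // mul1r => <-; congr (Pr _).
  have SN w : S N w = \sum_i c i * V i w.
    by apply: eq_bigl => i; rewrite ltn_ord.
  by apply/seteqP; split => w /=; rewrite SN.
elim: k => [_|k IHk kN] {A mA0} A B mA mB BT.
  have r0 : r 0%N = 0 by rewrite /r big_pred0 ?sqrtr0.
  have S0 w : S 0%N w = 0 by rewrite /S big_pred0.
  rewrite r0 law0 /= diracE.
  have [A0|A0] := pselect (A 0).
    rewrite mem_set // mul1e; congr (Pr _); rewrite -[RHS]setTI; congr (_ `&` _).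
    by apply/seteqP; split => w //= _; rewrite S0.
  rewrite memNset // mul0e -[RHS](measure0 Pr); congr (Pr _).
  by apply/seteqP; split => w //= [+ _]; rewrite S0.
pose kk := Ordinal kN.
have predE (i : 'I_N) : ((i < k.+1)%N && (i != kk)) = (i < k)%N.
  by rewrite ltnS ltn_neqAle andbC -val_eqE.
have Sk w : S k.+1 w = S k w + c kk * V kk w.
  rewrite /S (bigD1 kk) /= ?ltnSn // addrC; congr (_ + _).
  exact: eq_bigl.
have rk : r k.+1 ^+ 2 = r k ^+ 2 + c kk ^+ 2.
  rewrite !r2 (bigD1 kk) /= ?ltnSn // addrC; congr (_ + _).
  exact: eq_bigl.
have r_ge0 j : 0 <= r j by exact: sqrtr_ge0.
(* A zero coefficient is set apart because the scaled summand is then a constant and has no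
   density. *)
have [ck0|ck0] := eqVneq (c kk) 0.
  have -> : r k.+1 = r k.
    by apply/eqP; rewrite -(@eqrXn2 _ 2) // rk ck0 expr0n addr0.
  rewrite -IHk ?(ltnW kN) // => [|i ik]; last by rewrite BT // ltnS ltnW.
  by congr (Pr (_ `&` _)); apply/seteqP; split => w /=; rewrite Sk ck0 mul0r addr0.
set E := \bigcap_i (V i @^-1` B i).
have mEB : measurable E := mE B mB.
have mX : measurable [set w | A (S k.+1 w)].
  by rewrite -[X in measurable X]setTI; exact: (mS k.+1 measurableT A mA).
(* The conditioning on [E] below divides by its probability. *)
have [E0|E0] := eqVneq (Pr E) 0%E.
  rewrite E0 mule0; apply/eqP; rewrite eq_le measure_ge0 andbT -E0.
  by apply: le_measure; [exact/mem_set/measurableI|exact/mem_set|exact: subIsetr].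
pose p := fine (Pr E).
have pE : Pr E = p%:E by rewrite /p fineK // fin_num_measure.
have p0 : 0 < p by rewrite -lte_fin -pE lt_neqAle eq_sym E0 measure_ge0.
have cs0 : c kk * sigma != 0 by rewrite mulf_neq0.
pose f w : measurableTypeR R * measurableTypeR R := (S k w, c kk * V kk w).
have mf : measurable_fun setT f.
  apply/measurable_fun_pair => //.
  exact: measurable_funM.
have pV0 : 0 <= p^-1 by rewrite invr_ge0 ltW.
(* The joint law of the partial sum and the next summand, conditioned on [E]. Once it is known to be
   a product law, the statement is the convolution of two normal laws. *)
pose m'_ := mscale (NngNum pV0) (pushforward (mrestr Pr mEB) f).
pose m' := m'_ mf.
pose m2 : probability (measurableTypeR R) R := normal_prob 0 (c kk * sigma).
have m'E A1 A2 : measurable A1 -> measurable A2 ->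
    m' (A1 `*` A2) = (law (r k) A1 * m2 A2)%E.
  move=> mA1 mA2; rewrite -[LHS]/(p^-1%:E * Pr (f @^-1` (A1 `*` A2) `&` E))%E.
  (* Coordinate [kk] is unconstrained in [B]; lodging the event on the next summand there brings the
     rectangle under the induction hypothesis. *)
  pose B' i := if i == kk then [set y : R | A2 (c kk * y)] else B i.
  have mB' i : measurable (B' i).
    rewrite /B'; case: eqP => // _.
    have -> : [set y : R | A2 (c kk * y)] = setT `&` affine (c kk) 0 @^-1` A2.
      by rewrite setTI; apply/seteqP; split => y; rewrite /affine /= addr0.
    exact: (measurable_affine (c kk) 0 measurableT mA2).
  have -> : f @^-1` (A1 `*` A2) `&` E =
      [set w | A1 (S k w)] `&` \bigcap_i (V i @^-1` B' i).
    apply/seteqP; split => w /= [].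
      move=> [A1w A2w] Ew; split => // i _ /=; rewrite /B'; case: eqP => [->//|_].
      exact: Ew.
    move=> A1w Ew; split.
      by split => //; have := Ew kk I; rewrite /B' /= eqxx.
    move=> i _ /=; have := Ew i I; rewrite /B' /=; case: eqP => [->|//].
    by rewrite BT.
  rewrite IHk ?(ltnW kN) //; last first.
    move=> i ik; rewrite /B' BT; last by rewrite ltnS ltnW.
    by case: eqP => // ikk; rewrite ikk /= ltnn in ik.
  have PE : Pr E = (\prod_(i | i != kk) Pr (V i @^-1` B i))%E.
    rewrite /E Vind // (bigD1 kk) //= BT ?ltnSn // preimage_setT.
    by rewrite probability_setT mul1e.
  rewrite Vind // (bigD1 kk) //=.
  rewrite (eq_bigr (fun i => Pr (V i @^-1` B i))); last first.
    by move=> i /negbTE ikk; rewrite /B' ikk.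
  rewrite -PE pE {1}/B' eqxx.
  have -> : Pr (V kk @^-1` [set y | A2 (c kk * y)]) = m2 A2.
    rewrite -[LHS]/(distribution Pr (V kk) _) Vlaw; first exact: normal_prob_scale.
    by have := mB' kk; rewrite /B' eqxx.
  by rewrite muleCA; congr (_ * _)%E; rewrite muleCA -EFinM mulVf ?mule1 ?gt_eqF.
pose D := [set xy : measurableTypeR R * measurableTypeR R | A (xy.1 + xy.2)].
have mDs : measurable D.
  rewrite -[D]setTI; have : measurable_fun setT
      (fun xy : measurableTypeR R * measurableTypeR R => xy.1 + xy.2 : measurableTypeR R).
    by apply: measurable_funD.
  exact.
have xsD x : xsection D x = [set y : R | A (x + y)].
  by apply/seteqP; split => y /=; [move=> /set_mem|move=> ?; exact/mem_set].
have -> : Pr ([set w | A (S k.+1 w)] `&` E) = (p%:E * m' D)%E.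
  rewrite -[X in (_ * X)%E]/(p^-1%:E * Pr (f @^-1` D `&` E))%E muleA -EFinM.
  rewrite divff ?gt_eqF // mul1e.
  by congr (Pr (_ `&` _)); apply/seteqP; split => w /=; rewrite Sk.
rewrite pE muleC; congr (_ * _)%E.
transitivity ((law (r k) \x m2) D)%E.
  by symmetry; exact: (product_measure_unique m'E).
rewrite /product_measure1.
have rS : r k.+1 != 0.
  by rewrite -sqrf_eq0 rk gt_eqF // ltr_wpDl ?sqr_ge0 // exprn_even_gt0.
have mx2 : measurable_fun setT (m2 \o xsection D) by exact: measurable_fun_xsection.
under eq_integral do rewrite /= xsD.
have mx3 : measurable_fun setT (fun x : R => m2 [set y | A (x + y)]).
  by apply: eq_measurable_fun mx2 => x _ /=; rewrite xsD.
rewrite (lawN (r k.+1)) //.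
have [rk0|rk0] := eqVneq (r k) 0.
  rewrite rk0 law0 integral_dirac //.
  rewrite diracT mul1e.
  have -> : [set y | A (0 + y)] = A by apply/seteqP; split => y /=; rewrite add0r.
  rewrite /m2; congr (_ A); apply: normal_prob_sqr => //.
  by rewrite !exprMn rk rk0 expr0n add0r.
rewrite lawN //=.
apply: normal_prob_conv => //.
- by rewrite mulf_neq0.
- by rewrite !exprMn rk mulrDl.
Qed.

End gaussian_linear_combination.

(** * Coefficients that are random but independent of the noise *)

Section independence.
Context {d : measure_display} {T : measurableType d} {R : realType}
  (Pr : probability T R).

(** The sample space with the coarser sigma-algebra generated by [X]: measurability from this type
    expresses dependence on [X] alone. *)
Definition generated_type (I : Type) (X : I -> {RV Pr >-> R}) :=
  g_sigma_algebraType (\bigcup_i preimage_set_system [set: T] (X i) measurable).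

Lemma measurable_generated (I : Type) (X : I -> {RV Pr >-> R}) i :
  measurable_fun [set: generated_type X] (X i : generated_type X -> R).
Proof.
move=> _ B mB; apply: sub_sigma_algebra; exists i => //.
by exists B.
Qed.

Lemma sigma_algebra_of_measurable (I : Type) (X : I -> {RV Pr >-> R}) :
  sigma_algebra_of X `<=` measurable.
Proof.
apply: smallest_sub; first exact: sigma_algebra_measurable.
by move=> _ [i _ [B mB <-]]; exact: (measurable_funP (X i) measurableT B mB).
Qed.

Lemma generated_id (I : Type) (X : I -> {RV Pr >-> R}) :
  measurable_fun [set: T] (idfun : T -> generated_type X).
Proof.
by move=> _ B mB; rewrite setTI; exact: (@sigma_algebra_of_measurable _ X B mB).
Qed.

(* Independence says that the diagonal map from [T] to [T] x [T], with the
   sigma-algebras generated by [X] and [V], has a product law; Fubini then reduces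
   to fixed coefficients. *)
Lemma normal_random_combination (I : Type) N (X : I -> {RV Pr >-> R})
    (V : 'I_N -> {RV Pr >-> R}) (sigma : R) (u : 'I_N -> T -> R) (A : set R) :
  sigma != 0 -> independent_families X V ->
  (forall i B, measurable B -> distribution Pr (V i) B = normal_prob 0 sigma B) ->
  mutually_independent V ->
  (forall i, measurable_fun [set: generated_type X] (u i : generated_type X -> R)) ->
  (forall w, \sum_i u i w ^+ 2 = 1) -> measurable A ->
  Pr [set w | A (\sum_i u i w * V i w)] = normal_prob 0 sigma A.
Proof.
move=> s0 XV Vlaw Vind mu_ u1 mA.
pose T1 := generated_type X; pose T2 := generated_type V.
pose id1 : {mfun T >-> T1} := HB.pack (idfun : T -> T1)
  (isMeasurableFun.Build _ _ _ _ _ (@generated_id _ X)).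
pose id2 : {mfun T >-> T2} := HB.pack (idfun : T -> T2)
  (isMeasurableFun.Build _ _ _ _ _ (@generated_id _ V)).
pose P1 : probability T1 R := distribution Pr id1.
pose P2 : probability T2 R := distribution Pr id2.
pose diag (w : T) : T1 * T2 := (w, w).
have mdiag : measurable_fun setT diag.
  by apply: measurable_fun_pair; exact: generated_id.
pose diagm : {mfun T >-> (T1 * T2)%type} :=
  HB.pack diag (isMeasurableFun.Build _ _ _ _ _ mdiag).
pose m' : probability (T1 * T2)%type R := distribution Pr diagm.
have m'E A1 A2 : measurable A1 -> measurable A2 -> m' (A1 `*` A2) = (P1 A1 * P2 A2)%E.
  by move=> mA1 mA2; exact: (XV A1 A2 mA1 mA2).
pose g (x : T1 * T2) : R := \sum_i u i x.1 * V i x.2.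
have mg : measurable_fun setT g.
  apply: measurable_sum => i; apply: measurable_funM.
    exact: (measurableT_comp (mu_ i) measurable_fst).
  exact: (measurableT_comp (@measurable_generated _ V i) measurable_snd).
have mD : measurable (g @^-1` A) by rewrite -[_ @^-1` _]setTI; exact: mg.
transitivity (m' (g @^-1` A)) => //.
rewrite -(product_measure_unique m'E mD) /product_measure1.
rewrite (eq_integral (cst (normal_prob 0 sigma A))); last first.
  move=> w _ /=.
  rewrite -(normal_linear_combination s0 Vlaw Vind (u1 w) mA).
  congr (Pr _); apply/seteqP.
  by split => w' /=; [move=> /set_mem|move=> ?; exact/mem_set].
rewrite integral_cst // -[RHS]mule1; congr (_ * _)%E; exact: (probability_setT Pr).
Qed.

End independence.

(** * Stochastic orders *)

Section stochastic_orders.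
Context {d : measure_display} {T : measurableType d} {R : realType}
  (Pr : probability T R).
Implicit Types (E F : nat -> set T) (X Y : nat -> T -> R).

(** Inner probability at least [1 - eps]: [eps] is the defect, and [E] itself may fail to be
    measurable. *)
Definition event_prob_ge (E : set T) (eps : R) : Prop :=
  exists A, [/\ measurable A, A `<=` E & (Pr (~` A) <= eps%:E)%E].

Definition asymp_sure E : Prop :=
  forall eps : R, 0 < eps -> \forall N \near \oo, event_prob_ge (E N) eps.

(** This is [o_p(1)], and [tight] is [O_p(1)], asked for large indices only. *)
Definition small_op X : Prop :=
  forall delta : R, 0 < delta -> asymp_sure (fun N => [set w | `|X N w| <= delta]).

Definition tight X : Prop :=
  forall eps : R, 0 < eps -> exists2 M : R, 0 < M &
    \forall N \near \oo, event_prob_ge [set w | `|X N w| <= M] eps.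

Lemma event_prob_geI (E F : set T) (eps eps' : R) :
  event_prob_ge E eps -> event_prob_ge F eps' ->
  event_prob_ge (E `&` F) (eps + eps').
Proof.
move=> [A [mA AE PA]] [B [mB BF PB]]; exists (A `&` B); split.
- exact: measurableI.
- exact: setISS.
- rewrite setCI EFinD; apply: le_trans (leeD PA PB).
  by apply: measureU2; exact: measurableC.
Qed.

Lemma event_prob_geS (E F : set T) (eps : R) : E `<=` F ->
  event_prob_ge E eps -> event_prob_ge F eps.
Proof. by move=> EF [A [mA AE PA]]; exists A; split => //; exact: subset_trans EF. Qed.

Lemma asymp_sureI E F : asymp_sure E -> asymp_sure F ->
  asymp_sure (fun N => E N `&` F N).
Proof.
move=> hE hF eps eps0; have e2 : 0 < eps / 2 by rewrite divr_gt0.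
near=> N; rewrite [eps]splitr; apply: event_prob_geI.
  by near: N; exact: hE.
by near: N; exact: hF.
Unshelve. all: by end_near. Qed.

Lemma asymp_sureS E F : (\forall N \near \oo, E N `<=` F N) ->
  asymp_sure E -> asymp_sure F.
Proof.
move=> EF hE eps eps0; near=> N; apply: (@event_prob_geS (E N)); first by near: N.
by near: N; exact: hE.
Unshelve. all: by end_near. Qed.

Lemma asymp_sure_near E : (\forall N \near \oo, forall w, E N w) -> asymp_sure E.
Proof.
move=> hE eps eps0; near=> N; have EN : forall w, E N w by near: N.
exists setT; split => [//|w _|]; first exact: EN.
by rewrite setCT measure0 lee_fin ltW.
Unshelve. all: by end_near. Qed.

Lemma asymp_sure_tending E : with_probability_tending_to_1 Pr E -> asymp_sure E.
Proof.
move=> [A AE /fine_cvgP[_ A1]] eps eps0; near=> N; have [mA sA] := AE N.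
exists (A N); split => //.
have : `|1 - fine (Pr (A N))| <= eps.
  by near: N; move/cvgrPdist_le : A1; apply.
rewrite probability_setC // -[Pr (A N)]fineK ?fin_num_measure // -EFinB lee_fin.
exact: le_trans (ler_norm _).
Unshelve. all: by end_near. Qed.

Lemma small_op_tight X : small_op X -> tight X.
Proof. by move=> hX eps eps0; exists 1 => //; exact: hX. Qed.

Lemma tight_le X Y : asymp_sure (fun N => [set w | `|X N w| <= `|Y N w|]) ->
  tight Y -> tight X.
Proof.
move=> XY hY eps eps0; have e2 : 0 < eps / 2 by rewrite divr_gt0.
have [M M0 hM] := hY _ e2; exists M => //.
near=> N; rewrite [eps]splitr.
apply: (@event_prob_geS ([set w | `|X N w| <= `|Y N w|] `&` [set w | `|Y N w| <= M])).
  by move=> w [/= XYw YM]; exact: le_trans YM.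
apply: event_prob_geI; first by near: N; exact: XY.
by near: N.
Unshelve. all: by end_near. Qed.

Lemma small_op_le X Y : asymp_sure (fun N => [set w | `|X N w| <= `|Y N w|]) ->
  small_op Y -> small_op X.
Proof.
move=> XY hY delta delta0; apply: asymp_sureS (asymp_sureI XY (hY _ delta0)).
by near=> N => w [/= XYw]; exact: le_trans.
Unshelve. all: by end_near. Qed.

Lemma tightD X Y : tight X -> tight Y -> tight (fun N w => X N w + Y N w).
Proof.
move=> hX hY eps eps0; have e2 : 0 < eps / 2 by rewrite divr_gt0.
have [M M0 hM] := hX _ e2; have [L L0 hL] := hY _ e2.
exists (M + L); first exact: addr_gt0.
near=> N; rewrite [eps]splitr.
apply: (@event_prob_geS ([set w | `|X N w| <= M] `&` [set w | `|Y N w| <= L])).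
  by move=> w [/= XM YL]; rewrite (le_trans (ler_normD _ _)) // lerD.
by apply: event_prob_geI; near: N.
Unshelve. all: by end_near. Qed.

Lemma tightM X Y : tight X -> tight Y -> tight (fun N w => X N w * Y N w).
Proof.
move=> hX hY eps eps0; have e2 : 0 < eps / 2 by rewrite divr_gt0.
have [M M0 hM] := hX _ e2; have [L L0 hL] := hY _ e2.
exists (M * L); first exact: mulr_gt0.
near=> N; rewrite [eps]splitr.
apply: (@event_prob_geS ([set w | `|X N w| <= M] `&` [set w | `|Y N w| <= L])).
  by move=> w [/= XM YL]; rewrite normrM ler_pM.
by apply: event_prob_geI; near: N.
Unshelve. all: by end_near. Qed.

Lemma small_opD X Y : small_op X -> small_op Y -> small_op (fun N w => X N w + Y N w).
Proof.
move=> hX hY delta delta0; have e2 : 0 < delta / 2 by rewrite divr_gt0.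
apply: asymp_sureS (asymp_sureI (hX _ e2) (hY _ e2)).
near=> N => w [/= XM YL]; rewrite (le_trans (ler_normD _ _)) //.
by rewrite [delta]splitr lerD.
Unshelve. all: by end_near. Qed.

Lemma small_opM X Y : small_op X -> tight Y -> small_op (fun N w => X N w * Y N w).
Proof.
move=> hX hY delta delta0 eps eps0; have e2 : 0 < eps / 2 by rewrite divr_gt0.
have [L L0 hL] := hY _ e2.
have dL : 0 < delta / L by rewrite divr_gt0.
near=> N; rewrite [eps]splitr.
apply: (@event_prob_geS ([set w | `|X N w| <= delta / L] `&` [set w | `|Y N w| <= L])).
  move=> w [/= XM YL]; rewrite normrM -[leRHS](divfK (lt0r_neq0 L0)).
  by rewrite ler_pM.
by apply: event_prob_geI; near: N => //; exact: hX.
Unshelve. all: by end_near. Qed.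

Lemma tight_cst (a : R) : tight (fun _ _ => a).
Proof.
move=> eps eps0; exists (`|a| + 1); first by rewrite ltr_wpDl.
by apply: asymp_sure_near => //; near=> N => w /=; rewrite lerDl.
Unshelve. all: by end_near. Qed.

Lemma small_op_cvg (a : nat -> R) : a N @[N --> \oo] --> 0 -> small_op (fun N _ => a N).
Proof.
move=> /cvgr0Pnorm_le ha delta delta0; apply: asymp_sure_near.
near=> N; have aN : `|a N| <= delta by near: N; exact: ha.
by move=> w.
Unshelve. all: by end_near. Qed.

Lemma eq_small_op X Y : asymp_sure (fun N => [set w | X N w = Y N w]) ->
  small_op X -> small_op Y.
Proof.
move=> XY; apply: small_op_le; apply: asymp_sureS XY.
by near=> N => w /= ->.
Unshelve. all: by end_near. Qed.

Lemma eq_tight X Y : asymp_sure (fun N => [set w | X N w = Y N w]) ->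
  tight X -> tight Y.
Proof.
move=> XY; apply: tight_le; apply: asymp_sureS XY.
by near=> N => w /= ->.
Unshelve. all: by end_near. Qed.

Lemma small_op_tight_cst X (c : R) : small_op (fun N w => X N w - c) -> tight X.
Proof.
move=> hX; have := tightD (small_op_tight hX) (tight_cst c).
by apply: eq_tight; apply: asymp_sure_near; near=> N => w; rewrite /= subrK.
Unshelve. all: by end_near. Qed.

(** Where [|X - c| <= |c| / 2] one has [|X| >= |c| / 2], so the error of the inverse is at most
    [2 / |c|^2] times that of [X]. *)
Lemma small_opV X (c : R) : c != 0 -> small_op (fun N w => X N w - c) ->
  small_op (fun N w => (X N w)^-1 - c^-1).
Proof.
move=> c0 hX.
have c2 : 0 < `|c| / 2 by rewrite divr_gt0 // normr_gt0.
have := small_opM hX (tight_cst (2 / `|c| ^+ 2)); apply: small_op_le.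
apply: asymp_sureS (hX _ c2); near=> N => w /= Xc.
have Xbig : `|c| / 2 <= `|X N w|.
  have := ler_normD (X N w) (c - X N w); rewrite addrC subrK distrC.
  by move: Xc; lra.
have X0 : X N w != 0 by rewrite -normr_gt0 (lt_le_trans c2).
have -> : (X N w)^-1 - c^-1 = (c - X N w) / (X N w * c) by field; rewrite X0 c0.
rewrite normrM distrC normrM ler_wpM2l // normfV normrM.
have -> : `|2 / `|c| ^+ 2| = (`|c| / 2 * `|c|)^-1.
  by rewrite ger0_norm ?divr_ge0 ?sqr_ge0 //; field; rewrite normr_eq0.
rewrite lef_pV2 ?posrE ?mulr_gt0 ?normr_gt0 // ler_wpM2r //.
Unshelve. all: by end_near. Qed.

(** The bound [|sqrt x - sqrt c| <= |x - c| / sqrt c] holds for every real [x], as the root of a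
    nonpositive number is 0; no event has to be discarded. *)
Lemma small_op_sqrt X (c : R) : 0 < c -> small_op (fun N w => X N w - c) ->
  small_op (fun N w => Num.sqrt (X N w) - Num.sqrt c).
Proof.
move=> c0 hX; have := small_opM hX (tight_cst (Num.sqrt c)^-1).
apply: small_op_le; apply: asymp_sure_near; near=> N => w /=.
rewrite normrM [`|_^-1|]gtr0_norm ?invr_gt0 ?sqrtr_gt0 // ler_pdivlMr ?sqrtr_gt0 //.
have [X0|X0] := leP (X N w) 0.
  have -> : `|Num.sqrt (X N w) - Num.sqrt c| = Num.sqrt c.
    by rewrite ler0_sqrtr // sub0r normrN ger0_norm ?sqrtr_ge0.
  rewrite -expr2 sqr_sqrtr ?(ltW c0) // ler0_norm ?opprB ?lerBrDr ?gerDl //.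
  by rewrite lerBlDr add0r (le_trans X0) ?ltW.
have -> : X N w - c = (Num.sqrt (X N w) - Num.sqrt c) * (Num.sqrt (X N w) + Num.sqrt c).
  by rewrite -subr_sqr !sqr_sqrtr // ltW.
rewrite normrM ler_wpM2l // ger0_norm ?addr_ge0 ?sqrtr_ge0 // lerDr.
exact: sqrtr_ge0.
Unshelve. all: by end_near. Qed.

Lemma small_op_sum (I : Type) (s : seq I) (P : pred I) (X : I -> nat -> T -> R) :
  (forall i, P i -> small_op (X i)) ->
  small_op (fun N w => \sum_(i <- s | P i) X i N w).
Proof.
move=> hX; elim: s => [|i s IHs].
  apply: (@eq_small_op (fun _ _ => 0)); last by apply: small_op_cvg; exact: cvg_cst.
  by apply: asymp_sure_near; near=> N => w /=; rewrite big_nil.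
have [Pi|Pi] := boolP (P i).
  apply: eq_small_op (small_opD (hX i Pi) IHs).
  by apply: asymp_sure_near; near=> N => w /=; rewrite big_cons Pi.
apply: eq_small_op IHs.
by apply: asymp_sure_near; near=> N => w /=; rewrite big_cons (negbTE Pi).
Unshelve. all: by end_near. Qed.

Lemma tight_sum (I : Type) (s : seq I) (P : pred I) (X : I -> nat -> T -> R) :
  (forall i, P i -> tight (X i)) ->
  tight (fun N w => \sum_(i <- s | P i) X i N w).
Proof.
move=> hX; elim: s => [|i s IHs].
  apply: (@eq_tight (fun _ _ => 0)); last exact: tight_cst.
  by apply: asymp_sure_near; near=> N => w /=; rewrite big_nil.
have [Pi|Pi] := boolP (P i).
  apply: eq_tight (tightD (hX i Pi) IHs).
  by apply: asymp_sure_near; near=> N => w /=; rewrite big_cons Pi.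
apply: eq_tight IHs.
by apply: asymp_sure_near; near=> N => w /=; rewrite big_cons (negbTE Pi).
Unshelve. all: by end_near. Qed.

End stochastic_orders.

(** * Tails of the normal law and Slutsky's argument *)

Section normal_limits.
Context {d : measure_display} {T : measurableType d} {R : realType}
  (Pr : probability T R).

Lemma measurable_normr_le (M : R) : measurable [set x : R | `|x| <= M].
Proof.
have -> : [set x : R | `|x| <= M] = `[(- M)%R, M]%classic.
  by apply/seteqP; split => x /=; rewrite in_itv /= ler_norml.
exact: measurable_itv.
Qed.

Lemma normal_prob_tail (m s eps : R) : 0 < eps ->
  exists2 M : R, 0 < M & (normal_prob m s (~` [set x : R | (`|x| <= M)%R]) <= eps%:E)%E.
Proof.
move=> eps0; pose F (k : nat) : set (measurableTypeR R) := [set x : R | `|x| <= k%:R].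
have mF k : measurable (F k) := measurable_normr_le k%:R.
pose P : probability (measurableTypeR R) R := normal_prob m s.
have FT : \bigcup_k F k = setT.
  apply/seteqP; split => // x _; exists (Num.bound `|x|) => //.
  by rewrite /F /= ltW // archi_boundP.
have := @nondecreasing_cvg_mu _ _ _ P F mF; rewrite FT.
move=> /(_ measurableT) H.
have {}H : P (F k) @[k --> \oo] --> P setT.
  apply: H => i j ij; apply/subsetPset => x /= xi; apply: le_trans xi _.
  by rewrite ler_nat.
have [k Pk] : exists k : nat, (1 - (P (F k)) <= eps%:E)%E.
  move: H; rewrite probability_setT => /fine_cvgP[_ /cvgrPdist_le/(_ eps eps0)].
  move=> [k _ /(_ k (leqnn k))] /= Pk; exists k.
  rewrite -[P (F k)]fineK ?fin_num_measure // -EFinB lee_fin.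
  exact: le_trans (ler_norm _) Pk.
(* One more than [k], which may be 0, to make the bound positive. *)
exists (k%:R + 1); first by rewrite ltr_wpDl.
apply: (@le_trans _ _ (P (~` F k))); last by rewrite probability_setC.
apply: (@le_measure _ _ _ P).
- apply/mem_set/measurableC; exact: measurable_normr_le.
- apply/mem_set; exact: measurableC.
- apply: subsetC => x /= xk; by rewrite (le_trans xk) // lerDl.
Qed.

Lemma tight_normal (n : nat) (sigma : R) (Z : nat -> T -> R) :
  (forall N, (n < N)%N -> measurable_fun setT (Z N)) ->
  (forall N A, (n < N)%N -> measurable A ->
    Pr [set w | A (Z N w)] = normal_prob 0 sigma A) ->
  tight Pr Z.
Proof.
move=> mZ lawZ eps eps0; have [M M0 PM] := @normal_prob_tail 0 sigma eps eps0.
exists M => //; near=> N.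
have nN : (n < N)%N by near: N; exists n.+1.
have mM := measurable_normr_le M.
exists (Z N @^-1` [set x | `|x| <= M]); split => //.
  by rewrite -[_ @^-1` _]setTI; exact: mZ.
rewrite preimage_setC; have := lawZ N _ nN (measurableC mM); rewrite /preimage => ->.
exact: PM.
Unshelve. all: by end_near. Qed.

(** For [N > n] the variable [r * Z N] has the limit law itself, with distribution function [F].
    Hence the distribution function at [x] of the scaled error is caught between
    [F (x - del) - eps / 2] and [F (x + del) + eps / 2], and the continuity of [F] at [x]
    concludes. *)
Lemma slutsky_normal (n : nat) (sigma r : R) (X : nat -> {RV Pr >-> R})
    (Z : nat -> T -> R) (a : R) :
  sigma != 0 -> r != 0 ->
  (forall N, (n < N)%N -> measurable_fun setT (Z N)) ->
  (forall N A, (n < N)%N -> measurable A ->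
    Pr [set w | A (Z N w)] = normal_prob 0 sigma A) ->
  small_op Pr (fun N w => Num.sqrt N%:R * (X N w - a) - r * Z N w) ->
  cvg_in_distribution Pr (fun N w => Num.sqrt N%:R * (X N w - a))
    (normal_prob 0 (r * sigma)).
Proof.
move=> s0 r0 mZ lawZ hop x Fcont.
pose P : probability (measurableTypeR R) R := normal_prob 0 (r * sigma).
pose F (y : R) := fine (P `]-oo, y]%classic).
have PF y : P `]-oo, y]%classic = (F y)%:E by rewrite /F fineK // fin_num_measure.
have mX N y : measurable [set w | Num.sqrt N%:R * (X N w - a) <= y].
  have -> : [set w | Num.sqrt N%:R * (X N w - a) <= y] =
     (fun w => Num.sqrt N%:R * (X N w - a)) @^-1` `]-oo, y]%classic.
    by apply/seteqP; split => w /=; rewrite in_itv.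
  rewrite -[_ @^-1` _]setTI; apply: measurable_funM => //.
  exact: measurable_funB.
pose p N := fine (Pr [set w | Num.sqrt N%:R * (X N w - a) <= x]).
have pE N : Pr [set w | Num.sqrt N%:R * (X N w - a) <= x] = (p N)%:E.
  by rewrite /p fineK // fin_num_measure.
have FZ N y : (n < N)%N -> Pr [set w | r * Z N w <= y] = (F y)%:E.
  move=> nN; rewrite -PF.
  have -> : P `]-oo, y]%classic =
      normal_prob 0 sigma [set z | `]-oo, y]%classic (r * z)].
    by rewrite normal_prob_scale.
  have mS : measurable [set z : R | `]-oo, y]%classic (r * z)].
    have -> : [set z : R | `]-oo, y]%classic (r * z)] =
        setT `&` affine r 0 @^-1` `]-oo, y]%classic.
      by rewrite setTI; apply/seteqP; split => z; rewrite /affine /= addr0.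
    exact: measurable_affine.
  rewrite -(lawZ N _ nN mS).
  by congr (Pr _); apply/seteqP; split => w /=; rewrite in_itv.
have mZy N y : (n < N)%N -> measurable [set w | r * Z N w <= y].
  move=> nN.
  have -> : [set w | r * Z N w <= y] = (fun w => r * Z N w) @^-1` `]-oo, y]%classic.
    by apply/seteqP; split => w /=; rewrite in_itv.
  rewrite -[_ @^-1` _]setTI; apply: measurable_funM => //; exact: mZ.
rewrite -/P PF; under eq_fun do rewrite pE.
apply: cvg_EFin; first by near=> N.
apply/cvgrPdist_le => eps eps0.
have e2 : 0 < eps / 2 by rewrite divr_gt0.
have [del del0 Fdel] : exists2 del, 0 < del &
    forall y, `|x - y| <= del -> `|F x - F y| <= eps / 2.
  have : F y @[y --> x] --> F x.
    by move: Fcont; rewrite /prop_for /continuous_at -/P PF => /fine_cvg.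
  move=> /cvgrPdist_le/(_ _ e2)/nbhs_ballP[e /= ee H].
  exists (e / 2); first by rewrite divr_gt0.
  move=> y xy; apply: H; rewrite /ball /=; apply: le_lt_trans xy _.
  by rewrite ltr_pdivrMr // ltr_pMr // ltr1n.
near=> N.
have nN : (n < N)%N by near: N; exists n.+1.
have [A [mA AE PA]] : event_prob_ge Pr
    [set w | `|Num.sqrt N%:R * (X N w - a) - r * Z N w| <= del] (eps / 2).
  by near: N; exact: hop.
have up : p N <= F (x + del) + eps / 2.
  rewrite -lee_fin EFinD -pE -(FZ N) //.
  apply: (@le_trans _ _ (Pr ([set w | r * Z N w <= x + del] `|` ~` A))).
    apply: le_measure; first exact/mem_set.
      by apply/mem_set/measurableU; [exact: mZy|exact: measurableC].
    move=> w /= Xx; have [Aw|Aw] := pselect (A w); last by right.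
    by left; have := AE _ Aw; rewrite /= ler_norml => /andP[]; lra.
  apply: (@le_trans _ _ (Pr [set w | (r * Z N w <= x + del)%R] + Pr (~` A))%E).
    by apply: measureU2; [exact: mZy|exact: measurableC].
  exact: leeD.
have dn : F (x - del) <= p N + eps / 2.
  rewrite -lee_fin EFinD -pE -(FZ N) //.
  apply: (@le_trans _ _ (Pr ([set w | Num.sqrt N%:R * (X N w - a) <= x] `|` ~` A))).
    apply: le_measure; first exact/mem_set/mZy.
      by apply/mem_set/measurableU; [exact: mX|exact: measurableC].
    move=> w /= Xx; have [Aw|Aw] := pselect (A w); last by right.
    by left; have := AE _ Aw; rewrite /= ler_norml => /andP[]; lra.
  apply: (@le_trans _ _
    (Pr [set w | (Num.sqrt N%:R * (X N w - a) <= x)%R] + Pr (~` A))%E).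
    by apply: measureU2; [exact: mX|exact: measurableC].
  exact: leeD.
have := Fdel (x + del); rewrite opprD addrA subrr sub0r normrN gtr0_norm //.
move=> /(_ (lexx _)).
have := Fdel (x - del); rewrite opprB addrC subrK gtr0_norm // => /(_ (lexx _)).
by rewrite /= !ler_norml => /andP[? ?] /andP[? ?]; lra.
Unshelve. all: by end_near. Qed.

End normal_limits.

(** * Measurable matrix expressions and Gaussian coordinates *)

Section measurable_matrices.
Context {d : measure_display} {T : measurableType d} {R : realType}.

Lemma measurable_det m (A : T -> 'M[R]_m) :
  (forall i j, measurable_fun setT (fun w => A w i j)) ->
  measurable_fun setT (fun w => \det (A w)).
Proof.
move=> mA; apply: measurable_sum => s; apply: measurable_funM => //.
by apply: measurable_prod => i _; exact: mA.
Qed.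

Lemma measurable_adj m (A : T -> 'M[R]_m) i j :
  (forall i j, measurable_fun setT (fun w => A w i j)) ->
  measurable_fun setT (fun w => (\adj (A w)) i j).
Proof.
move=> mA; under eq_fun do rewrite mxE.
apply: measurable_funM; first exact: measurable_cst.
apply: measurable_det => k l.
under eq_fun do rewrite !mxE; exact: mA.
Qed.

Lemma measurable_mulmx m p q (A : T -> 'M[R]_(m, p)) (B : T -> 'M[R]_(p, q)) i j :
  (forall i j, measurable_fun setT (fun w => A w i j)) ->
  (forall i j, measurable_fun setT (fun w => B w i j)) ->
  measurable_fun setT (fun w => (A w *m B w) i j).
Proof.
move=> mA mB; under eq_fun do rewrite mxE.
by apply: measurable_sum => k; exact: measurable_funM.
Qed.

End measurable_matrices.

Section gaussian_coordinate.
Context {d : measure_display} {T : measurableType d} {R : realType}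
  (Pr : probability T R).

(** The left-hand side is the scalar product of the noise with [y = Phi G^-1 b], and
    [|y|^2 = b^T G^-1 b]. Dividing by the norm leaves a unit vector that depends on [Phi] only. *)
Lemma gaussian_coordinate N n (Phi : 'I_N -> 'I_n -> {RV Pr >-> R})
    (V : 'I_N -> {RV Pr >-> R}) (sigma : R) (b : 'cV[R]_n) :
  (0 < N)%N -> sigma != 0 ->
  (forall i B, measurable B -> distribution Pr (V i) B = normal_prob 0 sigma B) ->
  mutually_independent V ->
  independent_families (fun ij : 'I_N * 'I_n => Phi ij.1 ij.2) V ->
  exists Z : T -> R, [/\ measurable_fun setT Z,
    forall A, measurable A -> Pr [set w | A (Z w)] = normal_prob 0 sigma A &
    forall w, let G := (rvmx Phi w)^T *m rvmx Phi w in G \in unitmx ->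
      (b^T *m (invmx G *m ((rvmx Phi w)^T *m rvcol V w))) 0 0 =
      Num.sqrt (quad (invmx G) b) * Z w].
Proof.
case: N Phi V => // N Phi V _ s0 Vlaw Vind PV.
set X := (fun ij : 'I_N.+1 * 'I_n => Phi ij.1 ij.2) in PV.
pose G w := (rvmx Phi w)^T *m rvmx Phi w.
(* The adjugate instead of the inverse keeps the coefficients polynomial in
   [Phi], hence measurable; after normalisation both give the same vector. *)
pose c w : 'cV[R]_N.+1 := rvmx Phi w *m (\adj (G w) *m b).
pose s w := \sum_i (c w i 0) ^+ 2.
(* The default [e_0] keeps the coefficient vector of norm 1 at every outcome, including those with a
   singular Gram matrix. *)
pose u i w := if s w == 0 then (i == ord0)%:R else c w i 0 * (s w `^ (- 2^-1)).
have mPhi i j : measurable_fun setT ((fun w => rvmx Phi w i j) : generated_type X -> R).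
  apply: eq_measurable_fun (@measurable_generated _ _ _ Pr _ X (i, j)) => w _ /=.
  by rewrite mxE.
have mG i j : measurable_fun setT ((fun w => G w i j) : generated_type X -> R).
  apply: measurable_mulmx => // k l.
  by apply: eq_measurable_fun (mPhi l k) => w _ /=; rewrite [RHS]mxE.

have mc i : measurable_fun setT ((fun w => c w i 0) : generated_type X -> R).
  apply: measurable_mulmx => // k l; apply: measurable_mulmx => // k' l'.
  exact: measurable_adj.
have ms : measurable_fun setT (s : generated_type X -> R).
  by apply: measurable_sum => i; exact: measurable_funX.
have mu_ i : measurable_fun setT (u i : generated_type X -> R).
  apply: measurable_fun_ifT => //.
    exact: measurable_fun_eqr.
  apply: measurable_funM => //.
  exact: (measurableT_comp (measurable_powR (- 2^-1)) ms).
have s_ge0 w : 0 <= s w by apply: sumr_ge0 => i _; exact: sqr_ge0.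
have sE w : s w `^ (- 2^-1) = (Num.sqrt (s w))^-1.
  by rewrite powRN powR12_sqrt.
have u1 w : \sum_i u i w ^+ 2 = 1.
  rewrite /u; have [s00|s00] := eqVneq (s w) 0.
    rewrite (bigD1 ord0) //= ?eqxx expr1n big1 ?addr0 // => i /negbTE ->.
    by rewrite expr0n.
  under eq_bigr do rewrite exprMn.
  by rewrite -mulr_suml -/(s w) sE exprVn sqr_sqrtr // divff.
exists (fun w => \sum_i u i w * V i w); split.
- apply: measurable_sum => i; apply: measurable_funM => //.
  exact: (measurableT_comp (mu_ i) (@generated_id _ _ _ Pr _ X)).
- move=> A mA.
  exact: (normal_random_combination s0 PV Vlaw Vind mu_ u1 mA).
- move=> w /= Gu; rewrite -/(G w) in Gu *.
  have [U [g [U1 GE g0]]] := gram_spec Gu.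
  have detG : 0 < \det (G w) by rewrite /G GE det_spec // prodr_gt0.
  set K := invmx (G w).
  have KT : K^T = K by rewrite /K trmx_inv /G trmx_mul trmxK.
  have cE : c w = \det (G w) *: (rvmx Phi w *m (K *m b)).
    rewrite /c /K /invmx Gu -!scalemxAl -!scalemxAr scalerA divff ?scale1r //.
    by rewrite gt_eqF.
  set y := rvmx Phi w *m (K *m b) in cE.
  have yy : \sum_i (y i 0) ^+ 2 = quad K b.
    have -> : \sum_i (y i 0) ^+ 2 = (y^T *m y) 0 0.
      by rewrite mxE; apply: eq_bigr => i _; rewrite [y^T _ _]mxE expr2.
    rewrite /y !trmx_mul KT -!mulmxA (mulmxA (rvmx Phi w)^T) -/(G w) (mulmxA K).
    by rewrite mulVmx // mul1mx mulmxA.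
  have sK : s w = \det (G w) ^+ 2 * quad K b.
    rewrite /s -yy mulr_sumr; apply: eq_bigr => i _.
    by rewrite cE mxE exprMn.
  have -> : (b^T *m (K *m ((rvmx Phi w)^T *m rvcol V w))) 0 0 = \sum_i y i 0 * V i w.
    have -> : b^T *m (K *m ((rvmx Phi w)^T *m rvcol V w)) = y^T *m rvcol V w.
      by rewrite /y !trmx_mul KT !mulmxA.
    by rewrite mxE; apply: eq_bigr => i _; rewrite mxE [rvcol _ _ _ _]mxE.
  have q_ge0 : 0 <= quad K b by rewrite -yy; apply: sumr_ge0 => i _; exact: sqr_ge0.
  have [q0|q0] := eqVneq (quad K b) 0.
    rewrite q0 sqrtr0 mul0r big1 // => i _.
    have /psumr_eq0P/(_ i isT) : \sum_i (y i 0) ^+ 2 = 0 by rewrite yy.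
    move=> /(_ (fun i _ => sqr_ge0 _))/eqP; rewrite sqrf_eq0 => /eqP ->.
    by rewrite mul0r.
  have sq0 : Num.sqrt (quad K b) != 0 by rewrite sqrtr_eq0 -ltNge lt_neqAle eq_sym q0.
  have sw0 : s w != 0 by rewrite sK mulf_neq0 // expf_neq0 // gt_eqF.
  rewrite mulr_sumr; apply: eq_bigr => i _.
  have cy : c w i 0 = \det (G w) * y i 0 by rewrite cE mxE.
  rewrite /u (negbTE sw0) cy; move: (y i 0) => yi.
  rewrite sE sK sqrtrM ?sqr_ge0 // sqrtr_sqr gtr0_norm //.
  by field; rewrite sq0 gt_eqF.
Qed.

End gaussian_coordinate.

(** * Stochastic orders and convergence in probability for matrices *)

Section matrix_orders.
Context {d : measure_display} {T : measurableType d} {R : realType}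
  (Pr : probability T R).

Definition small_mx p q (X : nat -> T -> 'M[R]_(p, q)) :=
  forall i j, small_op Pr (fun N w => X N w i j).

Definition tight_mx p q (X : nat -> T -> 'M[R]_(p, q)) :=
  forall i j, tight Pr (fun N w => X N w i j).

Lemma asymp_sure_all (E : nat -> set T) : (forall N w, E N w) -> asymp_sure Pr E.
Proof. by move=> hE; apply: asymp_sure_near; near=> N. Unshelve. all: by end_near. Qed.

Lemma small_op_ext (X Y : nat -> T -> R) : (forall N w, X N w = Y N w) ->
  small_op Pr X -> small_op Pr Y.
Proof. by move=> XY; apply: eq_small_op; exact: asymp_sure_all. Qed.

Lemma tight_ext (X Y : nat -> T -> R) : (forall N w, X N w = Y N w) ->
  tight Pr X -> tight Pr Y.
Proof. by move=> XY; apply: eq_tight; exact: asymp_sure_all. Qed.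

Lemma eq_small_mx p q (X Y : nat -> T -> 'M[R]_(p, q)) :
  asymp_sure Pr (fun N => [set w | X N w = Y N w]) -> small_mx X -> small_mx Y.
Proof.
move=> XY hX i j; apply: eq_small_op (hX i j); apply: asymp_sureS XY.
by near=> N => w /= ->.
Unshelve. all: by end_near. Qed.

Lemma tight_mx_cst p q (A : 'M[R]_(p, q)) : tight_mx (fun _ _ => A).
Proof. by move=> i j; exact: tight_cst. Qed.

Lemma tight_mxM p q r (X : nat -> T -> 'M[R]_(p, q)) (Y : nat -> T -> 'M[R]_(q, r)) :
  tight_mx X -> tight_mx Y -> tight_mx (fun N w => X N w *m Y N w).
Proof.
move=> hX hY i j; apply: (@tight_ext (fun N w => \sum_k X N w i k * Y N w k j)).
  by move=> N w; rewrite mxE.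
by apply: tight_sum => k _; exact: tightM.
Qed.

Lemma small_mxMl p q r (X : nat -> T -> 'M[R]_(p, q)) (Y : nat -> T -> 'M[R]_(q, r)) :
  small_mx X -> tight_mx Y -> small_mx (fun N w => X N w *m Y N w).
Proof.
move=> hX hY i j; apply: (@small_op_ext (fun N w => \sum_k X N w i k * Y N w k j)).
  by move=> N w; rewrite mxE.
by apply: small_op_sum => k _; exact: small_opM.
Qed.

Lemma small_mxMr p q r (X : nat -> T -> 'M[R]_(p, q)) (Y : nat -> T -> 'M[R]_(q, r)) :
  tight_mx X -> small_mx Y -> small_mx (fun N w => X N w *m Y N w).
Proof.
move=> hX hY i j; apply: (@small_op_ext (fun N w => \sum_k Y N w k j * X N w i k)).
  by move=> N w; rewrite mxE; apply: eq_bigr => k _; rewrite mulrC.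
by apply: small_op_sum => k _; exact: small_opM.
Qed.

Lemma tight_mxT p q (X : nat -> T -> 'M[R]_(p, q)) :
  tight_mx X -> tight_mx (fun N w => (X N w)^T).
Proof. by move=> hX i j; apply: tight_ext (hX j i) => N w; rewrite mxE. Qed.

Definition cvg_prob (X : nat -> T -> R) (c : R) := small_op Pr (fun N w => X N w - c).

Lemma cvg_prob_tight X c : cvg_prob X c -> tight Pr X.
Proof. exact: small_op_tight_cst. Qed.

Lemma cvg_prob_cst (c : R) : cvg_prob (fun _ _ => c) c.
Proof.
apply: (@small_op_ext (fun _ _ => 0)); first by move=> *; rewrite subrr.
by apply: small_op_cvg; exact: cvg_cst.
Qed.

Lemma cvg_probM X Y a b : cvg_prob X a -> cvg_prob Y b ->
  cvg_prob (fun N w => X N w * Y N w) (a * b).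
Proof.
move=> hX hY; have hYt := cvg_prob_tight hY.
apply: small_op_ext (small_opD (small_opM hX hYt) (small_opM hY (tight_cst Pr a))).
by move=> N w /=; ring.
Qed.

Lemma cvg_prob_sum (I : Type) (s : seq I) (X : I -> nat -> T -> R) (a : I -> R) :
  (forall i, cvg_prob (X i) (a i)) ->
  cvg_prob (fun N w => \sum_(i <- s) X i N w) (\sum_(i <- s) a i).
Proof.
move=> hX; apply: (@small_op_ext (fun N w => \sum_(i <- s) (X i N w - a i))).
  by move=> N w; rewrite sumrB.
by apply: small_op_sum => i _; exact: hX.
Qed.

Lemma cvg_prob_prod (I : Type) (s : seq I) (X : I -> nat -> T -> R) (a : I -> R) :
  (forall i, cvg_prob (X i) (a i)) ->
  cvg_prob (fun N w => \prod_(i <- s) X i N w) (\prod_(i <- s) a i).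
Proof.
move=> hX; elim: s => [|i s IHs].
  rewrite big_nil; apply: small_op_ext (cvg_prob_cst 1) => N w /=.
  by rewrite big_nil.
rewrite big_cons; apply: small_op_ext (cvg_probM (hX i) IHs) => N w /=.
by rewrite big_cons.
Qed.

Definition cvg_prob_mx p q (X : nat -> T -> 'M[R]_(p, q)) (A : 'M[R]_(p, q)) :=
  forall i j, cvg_prob (fun N w => X N w i j) (A i j).

Lemma cvg_prob_det m (X : nat -> T -> 'M[R]_m) (A : 'M[R]_m) : cvg_prob_mx X A ->
  cvg_prob (fun N w => \det (X N w)) (\det A).
Proof.
move=> hX; apply: cvg_prob_sum => s; apply: cvg_probM; first exact: cvg_prob_cst.
by apply: cvg_prob_prod => i; exact: hX.
Qed.

Lemma cvg_prob_adj m (X : nat -> T -> 'M[R]_m) (A : 'M[R]_m) : cvg_prob_mx X A ->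
  cvg_prob_mx (fun N w => \adj (X N w)) (\adj A).
Proof.
move=> hX i j; rewrite /cvg_prob.
apply: (@small_op_ext (fun N w => cofactor (X N w) j i - cofactor A j i)).
  by move=> N w; rewrite !mxE.
apply: cvg_probM; first exact: cvg_prob_cst.
apply: cvg_prob_det => k l; apply: small_op_ext (hX (lift j k) (lift i l)) => N w.
by rewrite !mxE.
Qed.

Lemma cvg_prob_neq0 X c : c != 0 -> cvg_prob X c ->
  asymp_sure Pr (fun N => [set w | X N w != 0]).
Proof.
move=> c0 hX; have c2 : 0 < `|c| / 2 by rewrite divr_gt0 // normr_gt0.
apply: asymp_sureS (hX _ c2); near=> N => w /=; apply: contraPneq => ->.
rewrite sub0r normrN; apply/negP; rewrite -ltNge.
by rewrite ltr_pdivrMr // ltr_pMr ?normr_gt0 // ltr1n.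
Unshelve. all: by end_near. Qed.

Lemma cvg_prob_unitmx m (X : nat -> T -> 'M[R]_m) (A : 'M[R]_m) :
  A \in unitmx -> cvg_prob_mx X A ->
  asymp_sure Pr (fun N => [set w | X N w \in unitmx]).
Proof.
rewrite unitmxE unitfE => A0 /cvg_prob_det/(cvg_prob_neq0 A0).
by apply: asymp_sureS; near=> N => w /=; rewrite unitmxE unitfE.
Unshelve. all: by end_near. Qed.

(** Cramer's formula: the adjugate and the determinant are polynomial in the entries, and the
    determinant is asymptotically surely nonzero. *)
Lemma cvg_prob_invmx m (X : nat -> T -> 'M[R]_m) (A : 'M[R]_m) :
  A \in unitmx -> cvg_prob_mx X A ->
  cvg_prob_mx (fun N w => invmx (X N w)) (invmx A).
Proof.
move=> Au hX i j.
have Ad : \det A != 0 by rewrite -unitfE -unitmxE.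
have := cvg_probM (small_opV Ad (cvg_prob_det hX)) (cvg_prob_adj hX i j).
apply: eq_small_op; apply: asymp_sureS (cvg_prob_unitmx Au hX).
by near=> N => w /= Xu; rewrite /invmx Xu Au !mxE.
Unshelve. all: by end_near. Qed.

(** The resolvent identity [X^-1 - A^-1 = X^-1 (X - A) (- A^-1)] passes the rate through tight
    factors. *)
Lemma invmx_rate m (a : nat -> R) (X : nat -> T -> 'M[R]_m) (A : 'M[R]_m) :
  A \in unitmx -> cvg_prob_mx X A ->
  small_mx (fun N w => a N *: (X N w - A)) ->
  small_mx (fun N w => a N *: (invmx (X N w) - invmx A)).
Proof.
move=> Au hX hr.
have tK : tight_mx (fun N w => invmx (X N w)).
  by move=> i j; exact: (cvg_prob_tight (cvg_prob_invmx Au hX i j)).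
have := small_mxMl (small_mxMr tK hr) (tight_mx_cst (- invmx A)).
apply: eq_small_mx; apply: asymp_sureS (cvg_prob_unitmx Au hX).
near=> N => w /= Xu.
rewrite -scalemxAr -scalemxAl mulmxBr mulVmx // mulmxN mulmxBl mul1mx -mulmxA mulmxV //.
by rewrite mulmx1 opprB.
Unshelve. all: by end_near. Qed.

Lemma cvg_prob_mxM p q r (X : nat -> T -> 'M[R]_(p, q))
    (Y : nat -> T -> 'M[R]_(q, r)) A B :
  cvg_prob_mx X A -> cvg_prob_mx Y B ->
  cvg_prob_mx (fun N w => X N w *m Y N w) (A *m B).
Proof.
move=> hX hY i j; apply: (@small_op_ext (fun N w =>
    \sum_k X N w i k * Y N w k j - \sum_k A i k * B k j)).
  by move=> N w; rewrite !mxE.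
by apply: cvg_prob_sum => k; exact: cvg_probM.
Qed.

Lemma cvg_prob_mx_cst p q (A : 'M[R]_(p, q)) : cvg_prob_mx (fun _ _ => A) A.
Proof. by move=> i j; exact: cvg_prob_cst. Qed.

Lemma cvg_prob_tr m (X : nat -> T -> 'M[R]_m) (A : 'M[R]_m) : cvg_prob_mx X A ->
  cvg_prob (fun N w => \tr (X N w)) (\tr A).
Proof. by move=> hX; apply: cvg_prob_sum => i; exact: hX. Qed.

End matrix_orders.

(** * Positive definite matrices and closed forms of the limit minimisers *)

Section posdef_facts.
Context {R : realType} {n : nat}.
Implicit Types (A : 'M[R]_n) (x : 'cV[R]_n).

Lemma posdef_unitmx A : posdefmx A -> A \in unitmx.
Proof.
move=> pA; have [U [d [U1 AE]]] := spec_exists pA.1; rewrite AE in pA *.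
by apply: spec_unit => // i; rewrite gt_eqF // (posdef_spec U1 pA).
Qed.

Lemma posdef_invmx A : posdefmx A -> posdefmx (invmx A).
Proof.
move=> pA; split; first by rewrite trmx_inv pA.1.
move=> x x0; have Au := posdef_unitmx pA.
have := pA.2 (invmx A *m x); rewrite /quad trmx_mul trmx_inv pA.1.
rewrite -!mulmxA mulKVmx //; apply.
by apply: contra x0 => /eqP H; rewrite -(mulKVmx Au x) H mulmx0.
Qed.

Lemma quad_cube A x : A^T = A -> quad (A ^+ 3) x = quad A (A *m x).
Proof.
by move=> As; rewrite /quad trmx_mul As !exprS expr0 mulr1 -!mulmxE !mulmxA.
Qed.

Lemma posdef_cube_gt0 A x : posdefmx A -> x != 0 -> 0 < quad (A ^+ 3) x.
Proof.
move=> pA x0; rewrite quad_cube ?pA.1 //; apply: pA.2.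
by apply: contra x0 => /eqP Ax; rewrite -(mulKmx (posdef_unitmx pA) x) Ax mulmx0.
Qed.

Lemma posdef_tr_gt0 A : (0 < n)%N -> posdefmx A -> 0 < \tr A.
Proof.
move=> n0 pA; have [U [d [U1 AE]]] := spec_exists pA.1; rewrite AE in pA *.
have d0 := posdef_spec U1 pA; rewrite tr_spec // (bigD1 (Ordinal n0)) //=.
by rewrite ltr_pwDl // sumr_ge0 // => i _; rewrite ltW.
Qed.

(** For [P = t I] the limit function is [q / t + n ln t], with the single critical point [q / n] on
    the positive reals. Likewise [W_y] becomes [sigma^4 (q / t^2 - 2 s / t)], with its own [q] and
    [s = \tr (invmx Sigma)], and critical point [q / s]. *)
Lemma W_b_argmin (Omega : set R) (theta0 : 'cV[R]_n) (h : R) : (0 < n)%N ->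
  open Omega -> (forall t, Omega t -> 0 < t) ->
  argmin Omega (fun eta => W_b theta0 (eta%:M : 'M[R]_n)) h ->
  h = (theta0^T *m theta0) 0 0 / n%:R.
Proof.
move=> n0 Oo O0 hmin.
have Oh : Omega° h by move: hmin.1; rewrite openE in Oo; exact: Oo.
have h0 := O0 _ hmin.1.
set q := (theta0^T *m theta0) 0 0.
have WE t : 0 < t -> W_b theta0 (t%:M : 'M[R]_n) = q * t^-1 + n%:R * ln t.
  move=> t0; rewrite /W_b invmx_scalar det_scalar lnXn // mulr_natl; congr (_ + _).
  by rewrite /quad mul_mx_scalar -scalemxAl mxE mulrC.
have dW (t : R) : 0 < t -> is_derive t 1 (fun t => q * t^-1 + n%:R * ln t)
    (n%:R / t - q / t ^+ 2).
  move=> t0; have tn0 : t != 0 by rewrite gt_eqF.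
  have d1 := @is_deriveV _ id t _ 1 tn0 (is_derive_id _ _).
  have d2 := is_derive1_ln t0.
  apply: is_derive_eq; rewrite /GRing.scale /=.
  by field.
have := argmin_stationary Oh hmin O0 WE dW.
have nR : n%:R != 0 :> R by rewrite pnatr_eq0 -lt0n.
have hn0 : h != 0 by rewrite gt_eqF.
move=> H; apply: (mulfI (_ : n%:R / h ^+ 2 != 0)).
  by rewrite mulf_neq0 // invr_eq0 expf_neq0.
have -> : n%:R / h ^+ 2 * (q / n%:R) = q / h ^+ 2 by field; rewrite hn0 nR.
by move/subr0_eq: H => <-; field.
Qed.

Lemma W_y_argmin (Omega : set R) (sigma : R) (Sigma : 'M[R]_n) (theta0 : 'cV[R]_n)
    (h : R) :
  (0 < n)%N -> sigma != 0 -> posdefmx Sigma ->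
  open Omega -> (forall t, Omega t -> 0 < t) ->
  argmin Omega (fun eta => W_y sigma Sigma theta0 eta%:M) h ->
  h = quad (invmx Sigma) theta0 / \tr (invmx Sigma).
Proof.
move=> n0 s0 pS Oo O0 hmin.
have Oh : Omega° h by move: hmin.1; rewrite openE in Oo; exact: Oo.
have h0 := O0 _ hmin.1.
have t0 := posdef_tr_gt0 n0 (posdef_invmx pS).
set s := \tr _ in t0 *; set q := quad _ _.
have WE t : 0 < t -> W_y sigma Sigma theta0 t%:M =
    sigma ^+ 4 * (q * t^-1 ^+ 2) - 2 * sigma ^+ 4 * (s * t^-1).
  move=> tt0; rewrite /W_y invmx_scalar tr_scalar_mx !mul_mx_scalar.
  rewrite mul_scalar_mx scalerA mxtraceZ -/s [_ * s]mulrC; congr (_ * _ - _).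
  by rewrite /quad -scalemxAr -scalemxAl mxE -/(quad _ _) -/q mulrC expr2.
have dW (t : R) : 0 < t -> is_derive t 1 (fun t => sigma ^+ 4 * (q * t^-1 ^+ 2)
    - 2 * sigma ^+ 4 * (s * t^-1)) (2 * sigma ^+ 4 * (s / t ^+ 2 - q / t ^+ 3)).
  move=> tt0; have tn0 : t != 0 by rewrite gt_eqF.
  have d1 := @is_deriveV _ id t _ 1 tn0 (is_derive_id _ _).
  have d2 := is_deriveX 2 d1.
  apply: is_derive_eq; rewrite /GRing.scale /=.
  by field.
have := argmin_stationary Oh hmin O0 WE dW.
have hn0 : h != 0 by rewrite gt_eqF.
have sn0 : s != 0 by rewrite gt_eqF.
have c0 : 2 * sigma ^+ 4 != 0 by rewrite mulf_neq0 // expf_neq0.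
move=> /eqP; rewrite mulf_eq0 (negbTE c0) /= subr_eq0 => /eqP H.
apply: (mulfI (_ : s / h ^+ 3 != 0)).
  by rewrite mulf_neq0 // invr_eq0 expf_neq0.
have -> : s / h ^+ 3 * (q / s) = q / h ^+ 3 by field; rewrite hn0 sn0.
by rewrite -H; field.
Qed.

End posdef_facts.

Section root_N.
Context {R : realType}.

Lemma sqrt_nat_cvg_pinfty : (Num.sqrt (N%:R : R)) @[N --> \oo] --> +oo.
Proof.
apply/cvgryPge => A; near=> N.
apply: (le_trans (ler_norm A)); rewrite -sqrtr_sqr ler_sqrt ?ler0n //.
apply: (@le_trans _ _ (Num.bound (A ^+ 2))%:R).
  by apply/ltW/archi_boundP; exact: sqr_ge0.
by rewrite ler_nat; near: N; exact: nbhs_infty_ge.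
Unshelve. all: by end_near. Qed.

Lemma inv_sqrt_nat_cvg0 : (Num.sqrt (N%:R : R))^-1 @[N --> \oo] --> (0 : R).
Proof.
apply/gtr0_cvgV0; last exact: sqrt_nat_cvg_pinfty.
near=> N; rewrite sqrtr_gt0 ltr0n; near: N; exact: nbhs_infty_gt.
Unshelve. all: by end_near. Qed.

End root_N.

(** * Asymptotic expansion of the estimators *)

Section model.
Context {d : measure_display} {T : measurableType d} {R : realType}
  (Pr : probability T R) {n : nat}.
Variables (theta0 : 'cV[R]_n) (sigma : R)
  (Phi : forall N : nat, 'I_N -> 'I_n -> {RV Pr >-> R})
  (V : forall N : nat, 'I_N -> {RV Pr >-> R})
  (Sigma : 'M[R]_n) (delta : nat -> R).
Hypotheses (n_gt0 : (0 < n)%N) (sigma_gt0 : 0 < sigma)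
  (V_gauss : forall N, (n < N)%N -> forall (i : 'I_N) (B : set R),
    measurable B -> distribution Pr (V i) B = normal_prob 0 sigma B)
  (V_indep : forall N, (n < N)%N -> mutually_independent (@V N))
  (Phi_V_indep : forall N, (n < N)%N ->
    independent_families
      (fun ij : 'I_N * 'I_n => Phi ij.1 ij.2) (@V N))
  (Sigma_pd : posdefmx Sigma)
  (delta_neq0 : forall N, (n < N)%N -> delta N != 0)
  (A4_Op : bigOp Pr n
    (fun N w => fnorm (N%:R^-1 *: ((rvmx (@Phi N) w)^T *m rvmx (@Phi N) w)
                       - Sigma))
    delta)
  (A4_o : (delta : nat -> R^o) =o_\oo
            (fun N : nat => (Num.sqrt N%:R)^-1 : R^o)).

Let F N w := rvmx (@Phi N) w.
Let G N w := (F N w)^T *m F N w.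
Let H N w := N%:R^-1 *: G N w.
Let K N w := invmx (H N w).
Let S := invmx Sigma.
Let rt (N : nat) : R := Num.sqrt N%:R.
(** The error of the least squares estimate, scaled by the root of [N], wherever the Gram matrix is
    invertible. *)
Let D N w : 'cV[R]_n := rt N *: (invmx (G N w) *m ((F N w)^T *m rvcol (@V N) w)).

Lemma subr_mxE m p (A B : 'M[R]_(m, p)) i j : (A - B) i j = A i j - B i j.
Proof. by rewrite !mxE. Qed.

Lemma fnorm_entry m p (A : 'M[R]_(m, p)) i j : `|A i j| <= fnorm A.
Proof.
rewrite -sqrtr_sqr ler_sqrt; last first.
  by apply: sumr_ge0 => k _; apply: sumr_ge0 => l _; exact: sqr_ge0.
rewrite (bigD1 i) //= (bigD1 j) //= -addrA lerDl addr_ge0 //.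
  by apply: sumr_ge0 => l _; exact: sqr_ge0.
by apply: sumr_ge0 => k _; apply: sumr_ge0 => l _; exact: sqr_ge0.
Qed.

Lemma measurable_H_entry N i j : measurable_fun setT (fun w => (H N w - Sigma) i j).
Proof.
have mF k l : measurable_fun setT (fun w => F N w k l).
  by apply: eq_measurable_fun (measurable_funP (Phi k l)) => w _; rewrite /F mxE.
have mG : measurable_fun setT (fun w => G N w i j).
  apply: measurable_mulmx => // k l.
  by apply: eq_measurable_fun (mF l k) => w _; rewrite [RHS]mxE.
have : measurable_fun setT (fun w => N%:R^-1 * G N w i j - Sigma i j).
  by apply: measurable_funB => //; exact: measurable_funM.
by apply: eq_measurable_fun => w _; rewrite /H !mxE.
Qed.

Lemma gt_near : \forall N \near \oo, (n < N)%N.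
Proof. exact: nbhs_infty_gt. Qed.

Lemma rt_gt0 N : (n < N)%N -> 0 < rt N.
Proof. by move=> nN; rewrite sqrtr_gt0 ltr0n; exact: leq_trans nN. Qed.

Lemma rt_sqr N : rt N ^+ 2 = N%:R.
Proof. by rewrite sqr_sqrtr. Qed.

Lemma rate_H : small_mx Pr (fun N w => rt N *: (H N w - Sigma)).
Proof.
move=> i j del del0 eps eps0; have [L L0 hL] := A4_Op eps0.
(* With this constant in [A4_o], the bound [L * |delta N|] is at most [del / rt N]. *)
have dL : 0 < del / L by rewrite divr_gt0.
move/eqoP : A4_o => /(_ _ dL) hdelta.
near=> N.
have nN : (n < N)%N by near: N; exact: gt_near.
have dN : `|delta N| <= del / L * `|(rt N)^-1| by near: N.
have d0 := delta_neq0 nN.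
pose xi w := fnorm (H N w - Sigma).
have xi0 w : 0 <= xi w by exact: sqrtr_ge0.
pose B := [set w | L < `|xi w / delta N|].
(* The complement of [B] is to serve as the measurable subevent. Squaring turns [B] into a condition
   on a polynomial in the entries; [delta N != 0] allows clearing the quotient. *)
have mB : measurable B.
  have -> : B = (fun w => \sum_i \sum_j (H N w - Sigma) i j ^+ 2) @^-1`
      `](L * `|delta N|) ^+ 2, +oo[%classic.
    have BE w : (L < `|xi w / delta N|) = ((L * `|delta N|) ^+ 2 <
        \sum_i \sum_j (H N w - Sigma) i j ^+ 2).
      rewrite normrM normfV (ger0_norm (xi0 w)) ltr_pdivlMr ?normr_gt0 //.
      rewrite -ltr_sqr ?nnegrE ?mulr_ge0 ?(ltW L0) // /xi /fnorm sqr_sqrtr //.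
      by apply: sumr_ge0 => k _; apply: sumr_ge0 => l _; exact: sqr_ge0.
    by apply/seteqP; split => w; rewrite /B /= in_itv /= andbT BE.
  rewrite -[X in measurable X]setTI.
  have mS : measurable_fun setT (fun w => \sum_i \sum_j (H N w - Sigma) i j ^+ 2).
    apply: measurable_sum => k; apply: measurable_sum => l.
    by apply: measurable_funX; exact: measurable_H_entry.
  by apply: mS => //; exact: measurable_itv.
exists (~` B); split; first exact: measurableC.
  move=> w /= /negP; rewrite -leNgt normrM normfV (ger0_norm (xi0 w)).
  rewrite ler_pdivrMr ?normr_gt0 // => xiL.
  rewrite mxE normrM (ger0_norm (ltW (rt_gt0 nN))).
  rewrite -ler_pdivlMl ?rt_gt0 // mulrC.
  apply: (le_trans (fnorm_entry _ _ _)); apply: (le_trans xiL).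
  have rt0 := rt_gt0 nN.
  apply: (@le_trans _ _ (L * (del / L * `|(rt N)^-1|))).
    by rewrite ler_wpM2l // ltW.
  rewrite ger0_norm ?invr_ge0 ?(ltW rt0) // le_eqVlt; apply/orP; left; apply/eqP.
  by field; rewrite !gt_eqF.
by rewrite setCK; apply/ltW/hL.
Unshelve. all: by end_near. Qed.

Lemma cvg_H : cvg_prob_mx Pr H Sigma.
Proof.
move=> i j; have h := small_op_tight (small_op_cvg Pr (@inv_sqrt_nat_cvg0 R)).
have := small_opM (rate_H i j) h; apply: eq_small_op.
apply: asymp_sure_near; near=> N => w /=.
have nN : (n < N)%N by near: N; exact: gt_near.
have entry (a : R) (A B : 'M[R]_n) : (a *: (A - B)) i j = a * (A i j - B i j).
  by rewrite mxE subr_mxE.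
rewrite entry -/(rt N) mulrAC divff ?mul1r // gt_eqF ?rt_gt0 //.
Unshelve. all: by end_near. Qed.

Let Su : Sigma \in unitmx. Proof. exact: posdef_unitmx. Qed.
Let S_pd : posdefmx S. Proof. exact: posdef_invmx. Qed.

Lemma cvg_K : cvg_prob_mx Pr K S.
Proof. exact: cvg_prob_invmx Su cvg_H. Qed.

Lemma rate_K : small_mx Pr (fun N w => rt N *: (K N w - S)).
Proof. exact: invmx_rate Su cvg_H rate_H. Qed.

Lemma gram_facts_asymp : asymp_sure Pr (fun N => [set w |
  [/\ (n < N)%N, G N w \in unitmx & invmx (G N w) = N%:R^-1 *: K N w]]).
Proof.
apply: asymp_sureS (cvg_prob_unitmx Su cvg_H); near=> N => w /= Hu.
have nN : (n < N)%N by near: N; exact: gt_near.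
have N0 : N%:R != 0 :> R by rewrite pnatr_eq0 -lt0n; exact: leq_ltn_trans nN.
have GH : G N w = N%:R *: H N w by rewrite /H scalerA divff // scale1r.
have NHu : N%:R *: H N w \in unitmx by rewrite unitmxZ ?unitfE.
by split; rewrite ?GH // invmxZ.
Unshelve. all: by end_near. Qed.

Lemma cvg_quad_K (x : 'cV[R]_n) : cvg_prob Pr (fun N w => quad (K N w) x) (quad S x).
Proof.
have h := cvg_prob_mxM (cvg_prob_mx_cst Pr x^T) cvg_K.
exact: cvg_prob_mxM h (cvg_prob_mx_cst Pr x) 0 0.
Qed.

Definition standard_noise (Z : nat -> T -> R) :=
  (forall N, (n < N)%N -> measurable_fun setT (Z N)) /\
  (forall N A, (n < N)%N -> measurable A ->
    Pr [set w | A (Z N w)] = normal_prob 0 sigma A).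

Lemma noise_coordinate (b : 'cV[R]_n) : exists2 Z, standard_noise Z &
  asymp_sure Pr (fun N => [set w |
    (b^T *m D N w) 0 0 = Num.sqrt (quad (K N w) b) * Z N w]).
Proof.
have : forall N, exists Z : T -> R, (n < N)%N -> [/\ measurable_fun setT Z,
    forall A, measurable A -> Pr [set w | A (Z w)] = normal_prob 0 sigma A &
    forall w, let G := (rvmx (@Phi N) w)^T *m rvmx (@Phi N) w in G \in unitmx ->
      (b^T *m (invmx G *m ((rvmx (@Phi N) w)^T *m rvcol (@V N) w))) 0 0 =
      Num.sqrt (quad (invmx G) b) * Z w].
  move=> N; have [nN|nN] := boolP (n < N)%N; last by exists (cst 0).
  have [Z ZP] := @gaussian_coordinate _ _ _ Pr N n (@Phi N) (@V N) sigma b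
    (leq_ltn_trans (leq0n n) nN) (lt0r_neq0 sigma_gt0) (V_gauss nN) (V_indep nN)
    (Phi_V_indep nN).
  by exists Z.
move=> /choice[Z ZP]; exists Z.
  by split => [N nN|N A nN]; have [] := ZP N nN => // _ + _; exact.
apply: asymp_sureS gram_facts_asymp; near=> N => w [nN Gu KE] /=.
have [_ _ /(_ w Gu)] := ZP N nN; rewrite -/(F N w) -/(G N w) => H1.
rewrite /D -scalemxAr mxE H1 mulrA; congr (_ * _).
rewrite KE /quad -scalemxAr -scalemxAl mxE sqrtrM ?invr_ge0 // sqrtrV // mulrA.
by rewrite divff ?mul1r // gt_eqF ?rt_gt0.
Unshelve. all: by end_near. Qed.

(** The random deviation [sqrt (b^T K b)] may be replaced by its limit since [Z] is tight. Each [b]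
    comes with its own [Z]. *)
Lemma linear_clt (b : 'cV[R]_n) : b != 0 -> exists2 Z, standard_noise Z &
  small_op Pr (fun N w => (b^T *m D N w) 0 0 - Num.sqrt (quad S b) * Z N w).
Proof.
move=> b0; have [Z hZ ZE] := noise_coordinate b; exists Z => //.
have q0 : 0 < quad S b by exact: S_pd.2.
have := small_opM (small_op_sqrt q0 (cvg_quad_K b)) (tight_normal hZ.1 hZ.2).
apply: eq_small_op; apply: asymp_sureS ZE; near=> N => w /= ->.
by rewrite mulrBl.
Unshelve. all: by end_near. Qed.

Lemma tight_D : tight_mx Pr D.
Proof.
move=> i j; rewrite ord1.
have e0 : (delta_mx i 0 : 'cV[R]_n) != 0.
  by apply/eqP => /matrixP/(_ i 0)/eqP; rewrite !mxE !eqxx oner_eq0.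
have [Z hZ ZE] := linear_clt e0.
have := tightD (small_op_tight ZE)
  (tightM (tight_cst Pr (Num.sqrt (quad S (delta_mx i 0)))) (tight_normal hZ.1 hZ.2)).
apply: tight_ext => N w; rewrite subrK.
by rewrite trmx_delta -rowE mxE.
Qed.

Variables (Y : forall N : nat, T -> 'cV[R]_N)
  (Y_def : forall N w, Y N w = rvmx (@Phi N) w *m theta0 + rvcol (@V N) w)
  (Omega : set R) (Omega_gt0 : forall t, Omega t -> 0 < t).

Let theta_ls N w : 'cV[R]_n := invmx (G N w) *m ((F N w)^T *m Y N w).

Lemma theta_lsE N w : (n < N)%N -> G N w \in unitmx ->
  theta_ls N w = theta0 + (rt N)^-1 *: D N w.
Proof.
move=> nN Gu; rewrite /theta_ls Y_def !mulmxDr -/(F N w).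
rewrite [(F N w)^T *m (_ *m theta0)]mulmxA mulKmx // /D scalerA.
by rewrite mulVf ?scale1r // gt_eqF ?rt_gt0.
Qed.

Let cvg_tr_K : cvg_prob Pr (fun N w => \tr (K N w)) (\tr S).
Proof. exact: cvg_prob_tr cvg_K. Qed.

Let tight_tr_K : tight Pr (fun N w => \tr (K N w)).
Proof. exact: cvg_prob_tight cvg_tr_K. Qed.

Let tight_tr_H : tight Pr (fun N w => \tr (H N w)).
Proof. exact: cvg_prob_tight (cvg_prob_tr cvg_H). Qed.

Let small_inv_rt : small_op Pr (fun N _ => (rt N)^-1).
Proof. exact: small_op_cvg (@inv_sqrt_nat_cvg0 R). Qed.

(** As [\tr (invmx G)] is [\tr K / N] and the argument of [p] is invariant under scaling, the bound
    is [O_p(1 / N)]; one factor [1 / rt N] survives the multiplication by [rt N]. Here [p] is the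
    polynomial in [rho] from the root bounds. *)
Lemma estimator_remainder (h c : nat -> T -> R) (p : R -> R) :
  (forall X, tight Pr X -> tight Pr (fun N w => p (X N w))) ->
  asymp_sure Pr (fun N => [set w | G N w \in unitmx ->
    `|h N w - c N w| <= sigma ^+ 2 * \tr (invmx (G N w)) *
      p (\tr (G N w) * \tr (invmx (G N w)))]) ->
  small_op Pr (fun N w => rt N * (h N w - c N w)).
Proof.
move=> hp hc.
have tY : tight Pr (fun N w =>
    (sigma ^+ 2 * \tr (K N w)) * p (\tr (H N w) * \tr (K N w))).
  apply: tightM; first by apply: tightM tight_tr_K; exact: tight_cst.
  by apply: hp; exact: tightM.
apply: small_op_le (small_opM small_inv_rt tY).
apply: asymp_sureS (asymp_sureI gram_facts_asymp hc).
near=> N => w [[nN Gu KE] /= /(_ Gu)].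
have rt0 := rt_gt0 nN.
have N0 : N%:R != 0 :> R by rewrite -rt_sqr expf_neq0 // gt_eqF.
have -> : \tr (G N w) * \tr (invmx (G N w)) = \tr (H N w) * \tr (K N w).
  by rewrite KE /H !mxtraceZ; ring.
rewrite KE mxtraceZ -rt_sqr => hb.
apply: le_trans (ler_norm _); rewrite normrM (gtr0_norm rt0).
apply: (le_trans (ler_wpM2l (ltW rt0) hb)).
rewrite le_eqVlt; apply/orP; left; apply/eqP.
by field; rewrite gt_eqF.
Unshelve. all: by end_near. Qed.

Lemma quadD (A : 'M[R]_n) (x y : 'cV[R]_n) (c : R) : A^T = A ->
  quad A (x + c *: y) = quad A x + 2 * c * (x^T *m A *m y) 0 0 + c ^+ 2 * quad A y.
Proof.
move=> As; rewrite /quad [(_ + _)^T]linearD linearZ /= !mulmxDl !mulmxDr.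
rewrite -!scalemxAl -!scalemxAr scalerA.
have -> : y^T *m A *m x = (x^T *m A *m y)^T by rewrite !trmx_mul trmxK As mulmxA.
by rewrite !mxE; ring.
Qed.

(** With [th = theta0 + D / rt], the remainder splits into the distance [R1] from the minimiser to
    [|th|^2 / n], the quadratic term [R2], and the Gaussian replacement [R3] of the linear term
    [2 theta0^T D / n]. *)
Lemma EB_expansion (eta : nat -> T -> R) : theta0 != 0 ->
  asymp_sure Pr (fun N => [set w | Omega° (eta N w) /\
    argmin Omega (fun t => F_EB sigma (F N w) (Y N w) t%:M) (eta N w)]) ->
  exists2 Z, standard_noise Z &
    small_op Pr (fun N w => rt N * (eta N w - (theta0^T *m theta0) 0 0 / n%:R) -
      (2 / n%:R * Num.sqrt (quad S theta0)) * Z N w).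
Proof.
move=> th0 hmin; have [Z hZ ZE] := linear_clt th0; exists Z => //.
have R1 : small_op Pr (fun N w =>
    rt N * (eta N w - ((theta_ls N w)^T *m theta_ls N w) 0 0 / n%:R)).
  apply: (@estimator_remainder eta _ (fun r => 2 + r)).
    by move=> X hX; exact: tightD (tight_cst Pr 2) hX.
  apply: asymp_sureS hmin; near=> N => w [Oh hm] /= Gu.
  exact: (EB_estimator_bound sigma_gt0 n_gt0 Gu Omega_gt0 Oh hm).
have R2 : small_op Pr (fun N w => (rt N)^-1 * (((D N w)^T *m D N w) 0 0 * n%:R^-1)).
  apply: small_opM small_inv_rt _; apply: tightM; last exact: tight_cst.
  exact: (tight_mxM (tight_mxT tight_D) tight_D).
have R3 := small_opM ZE (tight_cst Pr (2 / n%:R)).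
apply: eq_small_op (small_opD (small_opD R1 R2) R3).
apply: asymp_sureS gram_facts_asymp; near=> N => w [nN Gu KE] /=.
rewrite (theta_lsE nN Gu).
have -> : ((theta0 + (rt N)^-1 *: D N w)^T *m (theta0 + (rt N)^-1 *: D N w)) 0 0 =
    (theta0^T *m theta0) 0 0 + 2 * (rt N)^-1 * (theta0^T *m D N w) 0 0 +
    (rt N)^-1 ^+ 2 * ((D N w)^T *m D N w) 0 0.
  have := quadD theta0 (D N w) (rt N)^-1 (trmx1 R n).
  by rewrite /quad !mulmx1.
by field; rewrite pnatr_eq0 -lt0n n_gt0 gt_eqF ?rt_gt0.
Unshelve. all: by end_near. Qed.

Lemma Sy_expansion (eta : nat -> T -> R) : theta0 != 0 ->
  asymp_sure Pr (fun N => [set w | Omega° (eta N w) /\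
    argmin Omega (fun t => F_Sy sigma (F N w) (Y N w) t%:M) (eta N w)]) ->
  exists2 Z, standard_noise Z &
    small_op Pr (fun N w => rt N * (eta N w - quad S theta0 / \tr S) -
      (2 / \tr S * Num.sqrt (quad (S ^+ 3) theta0)) * Z N w).
Proof.
(* The gradient of [quad S th / \tr S] at [theta0] is [2 b / \tr S], whence [quad S b], that is
   [quad (S ^+ 3) theta0], in the variance. *)
move=> th0 hmin; set b := S *m theta0.
have S0 : S \in unitmx by exact: posdef_unitmx.
have b0 : b != 0.
  by apply: contra th0 => /eqP Sb; rewrite -(mulKmx S0 theta0) -/b Sb mulmx0.
have bT : b^T = theta0^T *m S by rewrite /b trmx_mul S_pd.1.
have S3 : quad (S ^+ 3) theta0 = quad S b.
  exact: quad_cube S_pd.1.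
have [Z hZ ZE] := linear_clt b0; exists Z => //; rewrite S3.
set a := quad S theta0; set t := \tr S.
have t0 : 0 < t by exact: posdef_tr_gt0.
pose t_ N w := \tr (K N w).
have tn0 : t != 0 by rewrite gt_eqF.
have cinv : cvg_prob Pr (fun N w => (t_ N w)^-1) t^-1 := small_opV tn0 cvg_tr_K.
have tinv := cvg_prob_tight cinv.
have R1 : small_op Pr (fun N w =>
    rt N * (eta N w - quad (invmx (G N w)) (theta_ls N w) / \tr (invmx (G N w)))).
  apply: (@estimator_remainder eta _ (fun r => 3 + 3 * r + r ^+ 2)).
    move=> X hX; apply: tightD; last first.
      by apply: tight_ext (tightM hX hX) => N w; rewrite expr2.
    by apply: tightD (tight_cst Pr 3) _; exact: tightM (tight_cst Pr 3) hX.
  apply: asymp_sureS hmin; near=> N => w [Oh hm] /= Gu.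
  exact: (Sy_estimator_bound sigma_gt0 n_gt0 Gu Omega_gt0 Oh hm).
have rq : small_op Pr (fun N w => rt N * (quad (K N w) theta0 - a)).
  have h := small_mxMr (tight_mx_cst Pr theta0^T) rate_K.
  apply: small_op_ext (small_mxMl h (tight_mx_cst Pr theta0) 0 0) => N w.
  rewrite -scalemxAr -scalemxAl mulmxBr mulmxBl mxE; congr (_ * _).
  exact: subr_mxE.
have rT : small_op Pr (fun N w => rt N * (t_ N w - t)).
  have h := small_op_sum (index_enum 'I_n) (P := xpredT) (fun i _ => rate_K i i).
  by apply: small_op_ext h => N w; rewrite /t_ /t -linearB -mxtraceZ.
have KS : small_mx Pr (fun N w => K N w - S).
  by move=> i j; apply: small_op_ext (cvg_K i j) => N w; rewrite subr_mxE.
(* [R2] and [R3] replace [K] by [S] at [theta0], in the numerator and in the trace: here [K - S] is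
   multiplied by [rt N], so its rate is essential. [R4] and [R5] make the same replacement in the
   linear term, where consistency suffices; [R6] is the Gaussian replacement and [R7] the quadratic
   term. *)
have R2 := small_opM rq tinv.
have R3 := small_opM (small_opM rT tinv) (tight_cst Pr (- (a / t))).
have R4 := small_opM (small_opM
  (small_mxMl (small_mxMr (tight_mx_cst Pr theta0^T) KS) tight_D 0 0) tinv)
  (tight_cst Pr 2).
have R5 := small_opM cinv
  (tightM (tight_mxM (tight_mx_cst Pr b^T) tight_D 0 0) (tight_cst Pr 2)).
have R6 := small_opM ZE (tight_cst Pr (2 / t)).
have tK : tight_mx Pr K by move=> i j; exact: cvg_prob_tight (cvg_K i j).
have R7 := small_opM small_inv_rt
  (tightM (tight_mxM (tight_mxM (tight_mxT tight_D) tK) tight_D 0 0) tinv).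
have R123 := small_opD (small_opD R1 R2) R3.
apply: eq_small_op (small_opD (small_opD (small_opD (small_opD R123 R4) R5) R6) R7).
apply: asymp_sureS (asymp_sureI gram_facts_asymp (cvg_prob_neq0 tn0 cvg_tr_K)).
near=> N => w [[nN Gu KE] /= tN0].
have rt0 : rt N != 0 by rewrite gt_eqF ?rt_gt0.
rewrite (theta_lsE nN Gu) KE mxtraceZ -/(t_ N w).
have KT : (K N w)^T = K N w by rewrite /K trmx_inv /H linearZ /= /G trmx_mul trmxK.
have -> : quad (N%:R^-1 *: K N w) (theta0 + (rt N)^-1 *: D N w) = N%:R^-1 *
  (quad (K N w) theta0 + 2 / rt N * (theta0^T *m K N w *m D N w) 0 0 +
   (rt N)^-1 ^+ 2 * quad (K N w) (D N w)).
  by rewrite -quadD // /quad -scalemxAr -scalemxAl mxE.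
have -> : (theta0^T *m (K N w - S) *m D N w) 0 0 =
    (theta0^T *m K N w *m D N w) 0 0 - (b^T *m D N w) 0 0.
  by rewrite bT mulmxBr mulmxBl subr_mxE.
rewrite -/(quad (K N w) (D N w)).
have N0 : N%:R != 0 :> R by rewrite -rt_sqr expf_neq0.
by field; apply/and4P.
Unshelve. all: by end_near. Qed.

End model.

Lemma eq_cvg_in_distribution (d : measure_display) (T : measurableType d)
    (R : realType) (Pr : probability T R) (X : nat -> T -> R)
    (mu nu : probability (measurableTypeR R) R) :
  (forall A, mu A = nu A) -> cvg_in_distribution Pr X mu -> cvg_in_distribution Pr X nu.
Proof.
move=> munu hX x; rewrite -munu.
have -> : (fun y : R => nu `]-oo, y]%classic) = (fun y => mu `]-oo, y]%classic).
  by apply/funext => y; rewrite munu.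
exact: hX.
Qed.

Lemma centered_normalE (R : realType) (v s : R) (A : set R) : s != 0 -> v = s ^+ 2 ->
  normal_prob 0 s A = centered_normal v A.
Proof.
move=> s0 ->; rewrite /centered_normal /=; congr (_ A); apply: normal_prob_sqr => //.
by rewrite sqrtr_sqr real_normK ?num_real.
Qed.

Theorem corollary1 (d : measure_display) (T : measurableType d) (R : realType)
  (Pr : probability T R)
  (n : nat) (n_ge2 : (2 <= n)%N)
  (* the model, one instance for each sample size N > n *)
  (theta0 : 'cV[R]_n) (sigma : R) (sigma_gt0 : 0 < sigma)
  (Phi : forall N : nat, 'I_N -> 'I_n -> {RV Pr >-> R})
  (V : forall N : nat, 'I_N -> {RV Pr >-> R})
  (Y : forall N : nat, T -> 'cV[R]_N)
  (Y_def : forall N w,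
    Y N w = rvmx (Phi N) w *m theta0 + rvcol (V N) w)
  (Phi_rank : forall N, (n < N)%N ->
    \forall w \ae Pr, \rank (rvmx (Phi N) w) = n)
  (V_gauss : forall N, (n < N)%N -> forall (i : 'I_N) (B : set R),
    measurable B -> distribution Pr (V N i) B = normal_prob 0 sigma B)
  (V_indep : forall N, (n < N)%N -> mutually_independent (V N))
  (Phi_V_indep : forall N, (n < N)%N ->
    independent_families
      (fun ij : 'I_N * 'I_n => Phi N ij.1 ij.2) (V N))
  (* the hyper-parameter set and the estimators *)
  (Omega : set R)
  (eta_EB eta_Sy eta_EEB eta_MSEy : nat -> {RV Pr >-> R})
  (* (A1) *)
  (A1_EB : with_probability_tending_to_1 Pr (fun N => [set w |
    Omega° (eta_EB N w) /\
    argmin Omega (fun eta => F_EB sigma (rvmx (Phi N) w) (Y N w) eta%:M)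
      (eta_EB N w)]))
  (A1_Sy : with_probability_tending_to_1 Pr (fun N => [set w |
    Omega° (eta_Sy N w) /\
    argmin Omega (fun eta => F_Sy sigma (rvmx (Phi N) w) (Y N w) eta%:M)
      (eta_Sy N w)]))
  (A1_EEB : with_probability_tending_to_1 Pr (fun N => [set w |
    Omega° (eta_EEB N w) /\
    argmin Omega (fun eta => F_EEB sigma (rvmx (Phi N) w) theta0 eta%:M)
      (eta_EEB N w)]))
  (A1_MSEy : with_probability_tending_to_1 Pr (fun N => [set w |
    Omega° (eta_MSEy N w) /\
    argmin Omega (fun eta => F_MSEy sigma (rvmx (Phi N) w) theta0 eta%:M)
      (eta_MSEy N w)]))
  (* (A2) *)
  (A2_P : forall eta : R, Omega eta -> posdefmx (eta%:M : 'M[R]_n))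
  (Sigma : 'M[R]_n) (A2_Sigma : posdefmx Sigma)
  (A2_cvg : \forall w \ae Pr,
    N%:R^-1 *: ((rvmx (Phi N) w)^T *m rvmx (Phi N) w) @[N --> \oo] --> Sigma)
  (* (A3) *)
  (A3_b : let M := argmin Omega (fun eta => W_b theta0 (eta%:M : 'M[R]_n)) in
    M `<=` isolated M)
  (A3_y : let M := argmin Omega (fun eta => W_y sigma Sigma theta0 eta%:M) in
    M `<=` isolated M)
  (eta_b eta_y : R)
  (eta_b_min : argmin Omega (fun eta => W_b theta0 (eta%:M : 'M[R]_n)) eta_b)
  (eta_y_min : argmin Omega (fun eta => W_y sigma Sigma theta0 eta%:M) eta_y)
  (* (A4) *)
  (delta : nat -> R) (delta_neq0 : forall N, (n < N)%N -> delta N != 0)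
  (A4_Op : bigOp Pr n
    (fun N w => fnorm (N%:R^-1 *: ((rvmx (Phi N) w)^T *m rvmx (Phi N) w)
                       - Sigma))
    delta)
  (A4_cvg : delta N @[N --> \oo] --> 0)
  (A4_o : (delta : nat -> R^o) =o_\oo
            (fun N : nat => (Num.sqrt N%:R)^-1 : R^o))
  (* (A5) *)
  (A5 : open Omega) :
  [/\ cvg_in_distribution Pr
        (fun N w => Num.sqrt N%:R * (eta_EB N w - eta_b))
        (centered_normal
          (4 * sigma ^+ 2 / n%:R ^+ 2 * quad (invmx Sigma) theta0)),
      cvg_in_distribution Pr
        (fun N w => Num.sqrt N%:R * (eta_Sy N w - eta_y))
        (centered_normal
          (4 * sigma ^+ 2 / (\tr (invmx Sigma)) ^+ 2
           * quad (invmx Sigma ^+ 3) theta0)) &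
      (* the smallest eigenvalue tends to 0, the other ones being fixed; for the
         ratio, theta0 keeps a component along the smallest eigenvector u k *)
      forall Sigma_ : nat -> 'M[R]_n,
        (forall k, posdefmx (Sigma_ k)) ->
        (forall k l i, (1 <= i < n)%N ->
           eigval i (Sigma_ k) = eigval i (Sigma_ l)) ->
        eigval n (Sigma_ k) @[k --> \oo] --> 0 ->
        cond (Sigma_ k) @[k --> \oo] --> +oo /\
        forall (u : nat -> 'cV[R]_n) (c : R),
          (forall k, Sigma_ k *m u k = eigval n (Sigma_ k) *: u k /\
                     fnorm (u k) = 1) ->
          0 < c -> (forall k, c <= `|((u k)^T *m theta0) 0 0|) ->
          (quad (invmx (Sigma_ k)) theta0 / n%:R ^+ 2)
            / (quad (invmx (Sigma_ k) ^+ 3) theta0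
               / (\tr (invmx (Sigma_ k))) ^+ 2)
            @[k --> \oo] --> (1 / n%:R ^+ 2 : R) ].
Proof.
have n0 : (0 < n)%N by exact: leq_trans n_ge2.
have O0 t : Omega t -> 0 < t.
  move=> /A2_P[_ /(_ (delta_mx (Ordinal n0) 0))] H.
  have e0 : (delta_mx (Ordinal n0) 0 : 'cV[R]_n) != 0.
    by apply/eqP => /matrixP/(_ (Ordinal n0) 0)/eqP; rewrite !mxE !eqxx oner_eq0.
  have := H e0; rewrite /quad mul_mx_scalar -scalemxAl mxE trmx_delta mul_delta_mx.
  by rewrite !mxE !eqxx mulr1.
have s0 : sigma != 0 by rewrite gt_eqF.
have ebE := W_b_argmin n0 A5 O0 eta_b_min.
have eyE := W_y_argmin n0 s0 A2_Sigma A5 O0 eta_y_min.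
(* The minimiser [|theta0|^2 / n] of [W_b] lies in [Omega], hence is positive. This makes both limit
   variances positive, so that the limits are true normal laws. *)
have th0 : theta0 != 0.
  apply/eqP => th00; have := O0 _ eta_b_min.1; rewrite ebE th00 mulmx0 mxE mul0r.
  by rewrite ltxx.
have S_pd := posdef_invmx A2_Sigma.
have q0 : 0 < quad (invmx Sigma) theta0 by exact: S_pd.2.
have t0 := posdef_tr_gt0 n0 S_pd.
have q30 := posdef_cube_gt0 S_pd th0.
have nR : n%:R != 0 :> R by rewrite pnatr_eq0 -lt0n.
split; last exact: ill_conditioned_limit.
- have [Z [mZ lawZ] hZ] := EB_expansion n0 sigma_gt0 V_gauss V_indep Phi_V_indep
    A2_Sigma delta_neq0 A4_Op A4_o Y_def O0 th0 (asymp_sure_tending A1_EB).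
  rewrite -ebE in hZ.
  have r0 : 2 / n%:R * Num.sqrt (quad (invmx Sigma) theta0) != 0.
    by rewrite !mulf_neq0 ?invr_eq0 // gt_eqF // sqrtr_gt0.
  apply: eq_cvg_in_distribution (slutsky_normal s0 r0 mZ lawZ hZ) => A.
  apply: centered_normalE; first by rewrite mulf_neq0.
  by rewrite !exprMn exprVn sqr_sqrtr ?ltW //; ring.
- have [Z [mZ lawZ] hZ] := Sy_expansion n0 sigma_gt0 V_gauss V_indep Phi_V_indep
    A2_Sigma delta_neq0 A4_Op A4_o Y_def O0 th0 (asymp_sure_tending A1_Sy).
  rewrite -eyE in hZ.
  have r0 : 2 / \tr (invmx Sigma) * Num.sqrt (quad (invmx Sigma ^+ 3) theta0) != 0.
    by rewrite !mulf_neq0 ?invr_eq0 // gt_eqF // sqrtr_gt0.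
  apply: eq_cvg_in_distribution (slutsky_normal s0 r0 mZ lawZ hZ) => A.
  apply: centered_normalE; first by rewrite mulf_neq0.
  by rewrite !exprMn exprVn sqr_sqrtr ?ltW //; ring.
Qed.
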